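(* Let $f:\mathbb{R}^d\to\mathbb{R}$ be $L$-smooth ($L>0$) and bounded below. Let $(\sigma_n)_{n\ge1}$ be positive reals, $N\ge1$ an integer, $0<t<\frac{1}{2L(d+4)}$, and $\mathbf{x}_0\in\mathbb{R}^d$ deterministic. For $\sigma>0$, $\mathbf{x},\mathbf{u}\in\mathbb{R}^d$ let $\delta_\sigma(\mathbf{x};\mathbf{u})$ be either (one fixed choice throughout) $\frac{f(\mathbf{x}+\sigma\mathbf{u})-f(\mathbf{x})}{\sigma/2}$ or $\frac{f(\mathbf{x}+\sigma\mathbf{u})-f(\mathbf{x}-\sigma\mathbf{u})}{\sigma}$, and let $\mathbf{g}_\sigma(\mathbf{x};N)=\frac1N\sum_{n=1}^N\delta_\sigma(\mathbf{x};\mathbf{u}_n)\mathbf{u}_n$, where $\mathbf{u}_1,\dots,\mathbf{u}_N$ are i.i.d. with density $\pi^{-d/2}e^{-\|\mathbf{u}\|^2}$ (i.e. $\mathcal N(0,\tfrac12 I_d)$). Define $\mathbf{x}_{k+1}=\mathbf{x}_k-t\,\mathbf{g}_{\sigma_{k+1}}(\mathbf{x}_k;N)$, using fresh independent samples at each step. Then for every $k\ge1$, $$\min_{i=0,\dots,k-1}\mathbb{E}\|\nabla f(\mathbf{x}_i)\|^2\le \frac1k\cdot\frac{N}{N-2Lt(d+4)}\left(\frac{4\big(f(\mathbf{x}_0)-\mathbb{E} f_{\sigma_k}(\mathbf{x}_k)\big)}{t}+\Big(\frac{L^3t(d+6)^3}{4N}+\frac{2Ld}{t}\Big)\sum_{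i=1}^k\sigma_i^2\right).$$
   Context: For a measurable $f:\mathbb{R}^d\to\mathbb{R}$ and $\sigma>0$, the Gaussian smoothing of $f$ with radius $\sigma$ is $f_\sigma(\mathbf{x})=\pi^{-d/2}\int_{\mathbb{R}^d} f(\mathbf{x}+\sigma\mathbf{u})\,e^{-\|\mathbf{u}\|_2^2}\,d\mathbf{u}$, and $f_0=f$. A function is $L$-smooth if it is differentiable and its gradient is $L$-Lipschitz in the Euclidean norm. Expectations are over all random samples. *)

(* Defs.v *)
From HB Require Import structures.
From mathcomp Require Import all_boot all_order all_algebra.
From mathcomp Require Import all_classical all_reals all_analysis.
Set Implicit Arguments. Unset Strict Implicit. Unset Printing Implicit Defensive.
Import Order.TTheory GRing.Theory Num.Theory.
Import numFieldNormedType.Exports.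
Local Open Scope classical_set_scope.
Local Open Scope ring_scope.

Section Defs.
Variables (R : realType) (d : nat).

Definition enorm (v : 'rV[R]_d) : R := Num.sqrt (\sum_(i < d) v 0 i ^+ 2).

Definition grad (f : 'rV[R]_d -> R) (x : 'rV[R]_d) : 'rV[R]_d :=
  \row_(i < d) derive f x (delta_mx 0 i : 'rV[R]_d).

Definition Lsmooth (L : R) (f : 'rV[R]_d -> R) : Prop :=
  (forall x, differentiable f x) /\
  (forall x y, enorm (grad f x - grad f y) <= L * enorm (x - y)).

Definition setcoord (v : 'rV[R]_d) (i : 'I_d) (r : R) : 'rV[R]_d :=
  \row_(j < d) (if j == i then r else v 0 j).

Fixpoint gauss_iint (s : seq 'I_d) (F : 'rV[R]_d -> R) (v : 'rV[R]_d) : R :=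
  match s with
  | [::] => F v
  | i :: s' => (Num.sqrt pi)^-1 *
      Rintegral (@lebesgue_measure R) setT
        (fun r => expR (- r ^+ 2) * gauss_iint s' F (setcoord v i r))
  end.

(* Gaussian smoothing f_sigma(x) = pi^{-d/2} \int f(x + sigma u) e^{-|u|^2} du *)
Definition gsmooth (f : 'rV[R]_d -> R) (sigma : R) (x : 'rV[R]_d) : R :=
  if sigma == 0 then f x
  else gauss_iint (enum 'I_d) (fun u => f (x + sigma *: u)) 0.

Definition fdiff (central : bool) (f : 'rV[R]_d -> R) (sigma : R)
  (x u : 'rV[R]_d) : R :=
  if central then (f (x + sigma *: u) - f (x - sigma *: u)) / sigma
  else (f (x + sigma *: u) - f x) / (sigma / 2).

Definition gest (central : bool) (f : 'rV[R]_d -> R) (N : nat) (sigma : R)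
  (x : 'rV[R]_d) (us : 'I_N -> 'rV[R]_d) : 'rV[R]_d :=
  N%:R^-1 *: \sum_(n < N) (fdiff central f sigma x (us n) *: us n).

Fixpoint zo_iter (central : bool) (f : 'rV[R]_d -> R) (N : nat) (t : R)
  (sigma : nat -> R) (x0 : 'rV[R]_d) (us : nat -> 'I_N -> 'rV[R]_d) (k : nat)
  : 'rV[R]_d :=
  match k with
  | 0 => x0
  | k'.+1 => let x := @zo_iter central f N t sigma x0 us k' in
             x - t *: @gest central f N (sigma k'.+1) x (us k')
  end.
End Defs.

Definition mutually_independent {dT} {T : measurableType dT} {R : realType}
  (P : probability T R) (I : eqType) (X : I -> T -> R) : Prop :=
  forall (J : seq I) (B : I -> set R), uniq J -> (forall i, measurable (B i)) ->
    P (\bigcap_(i in [set` J]) (X i @^-1` B i)) =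
    (\prod_(i <- J) P (X i @^-1` B i))%E.

(* Main.v *)
Require Import Defs.
From HB Require Import structures.
From mathcomp Require Import all_boot all_order all_algebra.
From mathcomp Require Import all_classical all_reals all_analysis.
From mathcomp Require Import measurable_realfun.
From mathcomp Require Import ring lra.
Import Order.TTheory GRing.Theory Num.Theory.
Import numFieldNormedType.Exports.
Local Open Scope classical_set_scope.
Local Open Scope ring_scope.
Set Implicit Arguments.
Unset Strict Implicit.
Unset Printing Implicit Defensive.

(* The descent inequality is applied to [f] itself rather than to its smoothing.
   Writing a = grad f (x), p = <a, u> and delta = 2 p + r, L-smoothness gives
   |r| <= L sigma |u|^2 for both difference schemes.  Convexity of the square
   bounds |g|^2 by the average of delta^2 |u|^2 over the samples, so only the
   independence between the past and one sample is needed, and Young's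
   inequality leaves the moments E p^2 = |a|^2 / 2,
   E (p^2 |u|^2) = (d + 2) |a|^2 / 4, E |u|^4 = d (d + 2) / 4 and
   E |u|^6 <= 3 d^2 (d + 4) / 8.  Since L t (d + 4) <= 1 / 2 this yields
     E f(x_(k+1)) <= E f(x_k) - (t / 4) E |grad f (x_k)|^2 + L d sigma_(k+1)^2 / 4,
   which is summed over k.  The smoothing enters only at the last step, through
   f_sigma <= f + L d sigma^2 / 4.  Integrability propagates along the iteration
   because |grad f|^2 <= 2 L (f - inf f). *)

(** * Integrals with prescribed value *)

(** Integrability and value travel together, so linearity and comparison apply without separate
    integrability side conditions. *)
Definition has_integral {d} {T : measurableType d} {R : realType}
    (mu : {measure set T -> \bar R}) (Y : T -> R) (e : R) :=
  mu.-integrable setT (EFin \o Y) /\ (\int[mu]_x (Y x)%:E = e%:E)%E.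

Section has_integral.
Context {d} {T : measurableType d} {R : realType}.
Variable mu : {measure set T -> \bar R}.
Implicit Types Y Z : T -> R.

Lemma has_integral_uniq Y e e' :
  has_integral mu Y e -> has_integral mu Y e' -> e = e'.
Proof. by move=> [_ h] [_]; rewrite h => -[]. Qed.

Lemma integrable_has_integral Y : mu.-integrable setT (EFin \o Y) ->
  has_integral mu Y (\int[mu]_x Y x).
Proof. by move=> iY; split=> //; rewrite fineK// integrable_fin_num. Qed.

Lemma has_integral_meas Y e : has_integral mu Y e -> measurable_fun setT Y.
Proof. by move=> [/measurable_int/measurable_EFinP]. Qed.

Lemma has_integralD Y Z a b : has_integral mu Y a -> has_integral mu Z b ->
  has_integral mu (fun x => Y x + Z x) (a + b).
Proof.
move=> [iY hY] [iZ hZ]; split.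
  by rewrite (_ : EFin \o _ = (EFin \o Y) \+ (EFin \o Z))%E//; exact: integrableD.
by under eq_integral do rewrite EFinD; rewrite integralD//= hY hZ.
Qed.

Lemma has_integralZ (c : R) Y a : has_integral mu Y a ->
  has_integral mu (fun x => c * Y x) (c * a).
Proof.
move=> [iY hY]; split.
  by rewrite (_ : EFin \o _ = (fun x => c%:E * (EFin \o Y) x))%E//; exact: integrableZl.
by under eq_integral do rewrite EFinM; rewrite integralZl//= hY.
Qed.

Lemma has_integral0 : has_integral mu (fun=> 0) 0.
Proof. by split; [exact: integrable0|exact: integral0]. Qed.

Lemma has_integral_sum (I : Type) (s : seq I) (p : pred I) (Y : I -> T -> R)
    (e : I -> R) : (forall i, p i -> has_integral mu (Y i) (e i)) ->
  has_integral mu (fun x => \sum_(i <- s | p i) Y i x) (\sum_(i <- s | p i) e i).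
Proof.
move=> h; elim: s => [|i s IH].
  by rewrite big_nil; under eq_fun do rewrite big_nil; exact: has_integral0.
rewrite big_cons; under eq_fun do rewrite big_cons.
by case: ifPn => // pi; apply: has_integralD => //; exact: h.
Qed.

Lemma has_integral_ext Y Z e : Y =1 Z -> has_integral mu Y e -> has_integral mu Z e.
Proof. by move=> /funext ->. Qed.

Lemma le_has_integral Y Z a b : has_integral mu Y a -> has_integral mu Z b ->
  (forall x, Y x <= Z x) -> a <= b.
Proof.
move=> [iY hY] [iZ hZ] YZ; rewrite -lee_fin -hY -hZ.
by apply: le_integral => // x _; rewrite lee_fin.
Qed.

Lemma has_integral_dominated Y Z b : measurable_fun setT Y -> has_integral mu Z b ->
  (forall x, `|Y x| <= Z x) -> exists a, has_integral mu Y a.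
Proof.
move=> mY [iZ _] YZ; exists (\int[mu]_x Y x); apply: integrable_has_integral.
apply: le_integrable iZ => //; first exact/measurable_EFinP.
by move=> x _ /=; rewrite lee_fin (le_trans (YZ x))// ler_norm.
Qed.

(** The integral of a nonnegative function is a supremum over the simple functions below it, and a
    larger function has more of them. Through [le_integral_nomeas] this serves [gauss_iint] and
    [gsmooth], whose measurability is not established. *)
Lemma ge0_le_integral_nomeas (f g : T -> \bar R) :
  (forall x, (0 <= f x)%E) -> (forall x, (f x <= g x)%E) ->
  (\int[mu]_x f x <= \int[mu]_x g x)%E.
Proof.
move=> f0 fg; rewrite !ge0_integralTE//; last by move=> x; exact: le_trans (fg x).
apply: ub_ereal_sup => _ [h /= hf <-]; apply: ereal_sup_ubound; exists h => //=.
by move=> x; exact: le_trans (fg x).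
Qed.

Lemma le_integral_nomeas (f g : T -> \bar R) : (forall x, (f x <= g x)%E) ->
  (\int[mu]_x f x <= \int[mu]_x g x)%E.
Proof.
move=> fg; rewrite integralE [leRHS]integralE; apply: leeB.
  apply: ge0_le_integral_nomeas => x; first exact: funepos_ge0.
  by rewrite !funeposE ge_max !le_max lexx (fg x) !orbT.
apply: ge0_le_integral_nomeas => x; first exact: funeneg_ge0.
by rewrite !funenegE ge_max !le_max lexx leeN2 (fg x) !orbT.
Qed.
End has_integral.

Lemma has_integral_cst {d} {T : measurableType d} {R : realType}
    (P : probability T R) (c : R) : has_integral P (fun=> c) c.
Proof.
split; first exact: finite_measure_integrable_cst.
by rewrite integral_cst//= probability_setT mule1.
Qed.

(** * Independence *)

Section independence.
Context {d} {T : measurableType d} {R : realType} {I : choiceType}.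
Variables (P : probability T R) (X : I -> T -> R).
Hypothesis mX : forall i, measurable_fun setT (X i).
Hypothesis indX : mutually_independent P X.

(** Events that constrain finitely many coordinates other than [i0]: a pi-system generating the
    sigma-algebra of all the other variables. *)
Definition cylinders_avoiding (i0 : I) : set (set T) :=
  [set A | exists (J : seq I) (B : I -> set R),
    [/\ uniq J, i0 \notin J, forall i, measurable (B i) &
        A = \bigcap_(i in [set` J]) (X i @^-1` B i)]].

Lemma cylinders_avoidingT i0 : cylinders_avoiding i0 setT.
Proof.
exists [::], (fun=> setT); split=> //.
by apply/seteqP; split.
Qed.

Lemma cylinders_avoiding_measurable i0 : cylinders_avoiding i0 `<=` measurable.
Proof.
move=> _ [J [B [_ _ mB ->]]].
rewrite bigcap_seq; apply: bigsetI_measurable => i _.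
by rewrite -[X in measurable X]setTI; exact: mX.
Qed.

Lemma cylinders_avoiding_setI i0 : setI_closed (cylinders_avoiding i0).
Proof.
move=> _ _ [J1 [B1 [u1 n1 m1 ->]]] [J2 [B2 [u2 n2 m2 ->]]].
exists (undup (J1 ++ J2)), (fun i => (if i \in J1 then B1 i else setT) `&`
  (if i \in J2 then B2 i else setT)); split.
- exact: undup_uniq.
- by rewrite mem_undup mem_cat negb_or n1 n2.
- by move=> i; apply: measurableI; case: ifP.
- apply/seteqP; split=> w /=.
    by move=> [h1 h2] i /=; rewrite mem_undup mem_cat => _; split; case: ifP => ij //;
      [exact: h1|exact: h2].
  move=> h; split=> i /= iJ.
    by have [] := h i; rewrite /= ?mem_undup ?mem_cat ?iJ.
  by have [] := h i; rewrite /= ?mem_undup ?mem_cat ?iJ ?orbT.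
Qed.

(** Dynkin's argument: both sides are finite measures in [A] that agree on a pi-system containing
    the whole space, hence on the sigma-algebra it generates. *)
Lemma generated_independent i0 (C : set R) A : measurable C ->
  <<s cylinders_avoiding i0 >> A ->
  (P (A `&` X i0 @^-1` C) = P A * P (X i0 @^-1` C))%E.
Proof.
move=> mC sA.
have mXC : measurable (X i0 @^-1` C) by rewrite -[X in measurable X]setTI; exact: mX.
have p0 : 0 <= fine (P (X i0 @^-1` C)) by rewrite fine_ge0.
pose m1 : {measure set T -> \bar R} := mrestr P mXC.
pose m2 : {measure set T -> \bar R} := mscale (NngNum p0) P.
suff -> : (P (A `&` X i0 @^-1` C) = m2 A)%E.
  by rewrite /m2 /= /mscale /= fineK ?fin_num_measure// muleC.
rewrite -[LHS]/(m1 A).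
apply: (@g_sigma_algebra_measure_unique _ _ _ (cylinders_avoiding i0) _ (fun=> setT)) => //.
- exact: cylinders_avoiding_measurable.
- by move=> _; exact: cylinders_avoidingT.
- by apply/seteqP; split => // w _; exists 0%N.
- exact: cylinders_avoiding_setI.
- move=> _ [J [B [uJ nJ mB ->]]].
  rewrite /m1 /m2 /= /mrestr /mscale /= fineK ?fin_num_measure//.
  (* Intersecting with the event on [X i0] adds [i0] to the index list, so mutual independence
     applies to both [i0 :: J] and [J]. *)
  pose B' i := if i == i0 then C else B i.
  have e : \bigcap_(i in [set` J]) (X i @^-1` B i) `&` X i0 @^-1` C =
    \bigcap_(i in [set` (i0 :: J)]) (X i @^-1` B' i).
    apply/seteqP; split=> w /=.
      move=> [h1 h2] i /=; rewrite inE /B'; case: eqP => [->//|_] /= iJ.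
      exact: h1.
    move=> h; split.
      move=> i /= iJ; have := h i; rewrite /= inE iJ orbT /B' => /(_ isT).
      by case: eqP => // ii0; rewrite -ii0 iJ in nJ.
    by have := h i0; rewrite /= inE eqxx /B' => /(_ isT); rewrite eqxx.
  rewrite e !indX//; [|by rewrite /= nJ uJ|by move=> i; rewrite /B'; case: ifP].
  rewrite big_cons {1}/B' eqxx; congr (_ * _)%E; apply: eq_big_seq => i iJ.
  by rewrite /B'; case: eqP => // ii0; rewrite -ii0 iJ in nJ.
- by move=> _; rewrite /m1 /= /mrestr setTI (le_lt_trans (probability_le1 P mXC))// ltry.
Qed.

End independence.

(** * Expectation of a product of independent variables *)

Section product_mean.
Context {d} {T : measurableType d} {R : realType} (P : probability T R).

(** The joint law of [Y] and [Z] agrees with the product of their laws on rectangles, hence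
    everywhere; Fubini then factors the mean. *)
Lemma has_integral_indepM (Y Z : T -> R) (a b : R) :
  (forall A B : set R, measurable A -> measurable B ->
    (P (Y @^-1` A `&` Z @^-1` B) = P (Y @^-1` A) * P (Z @^-1` B))%E) ->
  has_integral P Y a -> has_integral P Z b ->
  has_integral P (fun w => Y w * Z w) (a * b).
Proof.
move=> YZ hY hZ.
have mY := has_integral_meas hY; have mZ := has_integral_meas hZ.
have mW : measurable_fun setT (fun w => (Y w, Z w)) by exact/measurable_fun_pairP.
pose Y' : {mfun T >-> R} := HB.pack Y (isMeasurableFun.Build _ _ _ _ _ mY).
pose Z' : {mfun T >-> R} := HB.pack Z (isMeasurableFun.Build _ _ _ _ _ mZ).
pose W : {mfun T >-> (R * R)%type} := HB.pack (fun w => (Y w, Z w)) (isMeasurableFun.Build _ _ _ _ _ mW).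
pose mu := distribution P Y'; pose nu := distribution P Z'.
have E (S : set (R * R)) : measurable S -> (mu \x nu)%E S = distribution P W S.
  apply: product_measure_unique => A B mA mB.
  by rewrite /mu /nu /distribution /= /pushforward -YZ.
pose h (z : R * R) := (z.1 * z.2)%:E.
have mh : measurable_fun setT h.
  apply/measurable_EFinP; apply: measurable_funM => //.
have mah : measurable_fun setT (abse \o h) by exact: measurableT_comp.
have iYmu : mu.-integrable setT EFin.
  by apply: integrable_pushforward => //; case: hY.
have iZnu : nu.-integrable setT EFin.
  by apply: integrable_pushforward => //; case: hZ.
have eY : (\int[mu]_x x%:E = a%:E)%E.
  by rewrite integral_distribution//; case: hY.
have eZ : (\int[nu]_x x%:E = b%:E)%E.
  by rewrite integral_distribution//; case: hZ.
(* By Tonelli, the integral of the absolute value is the product of the two first absolute moments,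
   both finite. *)
have ih : (mu \x nu)%E.-integrable setT h.
  apply/(integrable12ltyP _ _ mh).
  under eq_integral do under eq_integral do rewrite /h /= normrM EFinM.
  have fin (m : probability R R) : m.-integrable setT EFin ->
      (\int[m]_x `|x|%:E)%E \is a fin_num.
    by move=> im; apply: integrable_fin_num => //; exact: (integrable_norm (f := idfun)).
  under eq_integral => x _.
    rewrite ge0_integralZl//; last by apply/measurable_EFinP; exact: normr_measurable.
    rewrite -(fineK (fin nu iZnu)); over.
  rewrite ge0_integralZr//; last by rewrite lee_fin fine_ge0// integral_ge0.
    by rewrite -(fineK (fin mu iYmu)) -EFinM ltry.
  by apply/measurable_EFinP; exact: normr_measurable.
have eh : (\int[(mu \x nu)%E]_z h z = (a * b)%:E)%E.
  transitivity (\int[mu]_x \int[nu]_y h (x, y))%E; first by rewrite integral12_prod_meas1.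
  under eq_integral => x _.
    under eq_integral do rewrite /h /= EFinM.
    rewrite integralZl// eZ; over.
  by rewrite integralZr// eY.
have mhW : measurable_fun setT (h \o W) by exact: measurableT_comp.
have ihW : P.-integrable setT (h \o W).
  move/integrableP : ih => [_ ih]; apply/integrableP; split=> //.
  rewrite -[X in (X < _)%E]/(\int[P]_x ((abse \o h) \o W) x)%E.
  rewrite -(ge0_integral_distribution W mah) => [|y]; last exact: abse_ge0.
  rewrite (eq_measure_integral (mu \x nu)%E)// => A mA _; exact/esym/E.
split=> //.
rewrite -eh (eq_measure_integral (distribution P W)); last by move=> A mA _; exact: E.
by rewrite integral_distribution.
Qed.
End product_mean.

(** * Gaussian moments *)

Section gaussian_moments.
Context {R : realType}.
Local Notation mu := (@lebesgue_measure R).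

(** For |r| > 1, |r|^n <= r^(2n), and 1 + x <= e^x at x = r^2 / (2(n+1)), raised to the power n,
    gives an exponent at most r^2 / 2. Using n+1 instead of n avoids a division by zero at n = 0.
    The summand 1 covers |r| <= 1. *)
Lemma normrX_le_expR (n : nat) (r : R) :
  `|r| ^+ n <= (1 + (2 * n.+1%:R) ^+ n) * expR (r ^+ 2 / 2).
Proof.
have : (n%:R : R) <= n.+1%:R by rewrite ler_nat.
have : 0 < (n.+1%:R : R) by rewrite ltr0n.
move: (n.+1%:R : R) => N N0 nN.
have N1 : N != 0 by rewrite gt_eqF.
have h : (r ^+ 2) ^+ n <= (2 * N) ^+ n * expR (r ^+ 2 / 2).
  have -> : (r ^+ 2) ^+ n = (2 * N) ^+ n * (r ^+ 2 / (2 * N)) ^+ n.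
    by rewrite -exprMn; congr (_ ^+ _); field.
  apply: ler_wpM2l; first by rewrite exprn_ge0// mulr_ge0// ltW.
  apply: (@le_trans _ _ (expR (r ^+ 2 / (2 * N)) ^+ n)).
    apply: lerXn2r; rewrite ?nnegrE ?expR_ge0 ?divr_ge0 ?sqr_ge0 ?mulr_ge0 ?(ltW N0)//.
    by apply: le_trans (expR_ge1Dx _); rewrite lerDr.
  rewrite -expRM_natl ler_expR.
  rewrite (_ : _ * _ = (r ^+ 2 / 2) * (n%:R / N)); last by field.
  apply: ler_piMr; first by rewrite divr_ge0// sqr_ge0.
  by rewrite ler_pdivrMr ?mul1r.
have [r1|r1] := lerP `|r| 1.
  have e1 : 1 <= expR (r ^+ 2 / 2) by rewrite -expR0 ler_expR divr_ge0// sqr_ge0.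
  apply: (@le_trans _ _ (1 * 1)); first by rewrite mul1r exprn_ile1.
  by apply: ler_pM => //; rewrite lerDl exprn_ge0// mulr_ge0// ltW.
rewrite mulrDl mul1r; apply: (@le_trans _ _ ((r ^+ 2) ^+ n)).
  rewrite -[r ^+ 2]real_normK ?num_real// -exprM.
  by rewrite ler_weXn2l ?(ltW r1)// leq_pmull.
by apply: (le_trans h); rewrite lerDr expR_ge0.
Qed.

(** Half of the Gaussian exponent absorbs the power; the other half remains as a majorant, used for
    integrability and for decay at infinity. *)
Lemma gauss_momentum_bound (n : nat) : exists C : R, forall r : R,
  `|r ^+ n * gauss_fun r| <= C * expR (- (r ^+ 2 / 2)).
Proof.
exists (1 + (2 * n.+1%:R) ^+ n) => r.
rewrite normrM normrX (ger0_norm (gauss_fun_ge0 _)).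
apply: le_trans (ler_wpM2r (gauss_fun_ge0 r) (normrX_le_expR n r)) _.
rewrite -mulrA -expRD le_eqVlt; apply/orP; left; apply/eqP.
by congr (_ * expR _); lra.
Qed.

Lemma integrable_gauss_momentum n : mu.-integrable setT
  (EFin \o (fun r : R => r ^+ n * gauss_fun r)).
Proof.
have [C hC] := gauss_momentum_bound n.
(* The majorant is the standard normal density divided by its peak value. *)
have i1 : mu.-integrable setT (EFin \o (fun r : R => expR (- (r ^+ 2 / 2)))).
  have := integrable_normal_pdf (0 : R) 1.
  move=> /(integrableZl measurableT (normal_peak 1)^-1) ih.
  apply: eq_integrable ih => // r _ /=.
  rewrite normal_pdfE ?oner_eq0// -EFinM /normal_fun subr0 expr1n.
  rewrite mulKf ?gt_eqF ?normal_peak_gt0 ?oner_eq0//; congr (expR _)%:E; by field.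
apply: le_integrable (integrableZl measurableT C i1) => //.
  apply/measurable_EFinP; apply: measurable_funM; first exact: measurable_funX.
  exact: measurable_gauss_fun.
by move=> r _ /=; rewrite lee_fin (le_trans (hC r))// ler_norm.
Qed.

(** The fundamental theorem of calculus on growing symmetric intervals turns the integral into
    boundary terms; dominated convergence passes to the whole line. *)
Lemma integral_derivative_eq0 (F f : R -> R) :
  (forall x : R, is_derive x 1 F (f x)) -> continuous f ->
  mu.-integrable setT (EFin \o f) ->
  (fun n : nat => F n.+1%:R - F (- n.+1%:R)) @ \oo --> 0 ->
  has_integral mu f 0.
Proof.
move=> dF cf intf F0; split=> //.
(* Endpoints at n+1 keep the interval nondegenerate already at n = 0. *)
pose D n := `[- n.+1%:R, n.+1%:R]%classic : set R.
have DE n : (\int[mu]_(x in D n) (f x)%:E = (F n.+1%:R - F (- n.+1%:R))%:E)%E.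
  apply: continuous_FTC2.
  - by rewrite gtrN// ltr0n.
  - exact: continuous_subspaceT.
  - have cF x : {for x, continuous F}.
      by apply/differentiable_continuous/derivable1_diffP; case: (dF x).
    split; first by move=> x _; case: (dF x).
      by apply: cvg_at_right_filter; exact: cF.
    by apply: cvg_at_left_filter; exact: cF.
  - by move=> x _; rewrite derive1E; apply: derive_val.
have h1 : (\int[mu]_(x in D n) (f x)%:E)%E @[n --> \oo] --> (\int[mu]_x (f x)%:E)%E.
  rewrite (_ : (fun n => _) = fun n => \int[mu]_x ((EFin \o f) \_ (D n)) x)%E; last first.
    by apply/funext => n; rewrite integral_mkcond.
  apply: (@dominated_cvg _ _ _ mu setT measurableT _ _ (fun x => `|f x|%:E)%E) => //.
  - move=> n; apply: (measurable_restrictT _ _).1 => //.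
      by rewrite /D; exact: measurable_itv.
    by apply/measurable_EFinP/measurable_funTS; exact: continuous_measurable_fun.
  - move=> x _; apply: cvg_near_cst; exists (Num.bound `|x|) => // n /= nx.
    rewrite patchE mem_set// /D /= in_itv /= -ler_norml.
    rewrite (le_trans (ltW (archi_boundP (normr_ge0 x))))// ler_nat.
    exact: leqW.
  - by have := integrable_abse intf; apply: eq_integrable.
  - move=> n x _ /=; rewrite /patch; case: ifP => _ //=.
    by rewrite normr0 lee_fin.
have h2 : (\int[mu]_(x in D n) (f x)%:E)%E @[n --> \oo] --> 0%:E.
  by under eq_fun do rewrite DE; apply: cvg_EFin => //; exact: nearW.
exact: (cvg_unique _ h1 h2).
Qed.

Lemma gauss_boundary n : (fun k : nat => (k.+1%:R : R) ^+ n * gauss_fun k.+1%:R -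
   (- k.+1%:R) ^+ n * gauss_fun (- k.+1%:R)) @ \oo --> (0 : R).
Proof.
have [C hC] := gauss_momentum_bound n.
have C0 : 0 <= C.
  have := le_trans (normr_ge0 _) (hC 0); rewrite expr0n /= mul0r oppr0 expR0.
  by rewrite mulr1.
apply/norm_cvg0P.
apply: (@squeeze_cvgr _ _ _ _ (fun=> 0) (fun k => (4 * C) * harmonic k)).
- near=> k; rewrite normr_ge0 /=.
  (* With K = k+1 >= 1, exp(K^2 / 2) >= 1 + K^2 / 2 >= K / 2; the two boundary terms together then
     cost 4C / K. *)
  have e : expR (- (k.+1%:R ^+ 2 / 2)) <= 2 * (harmonic k : R).
    rewrite /harmonic expRN -[leRHS]invrK lef_pV2 ?posrE ?expR_gt0 ?invr_gt0 ?divr_gt0//.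
    apply: le_trans (expR_ge1Dx _); rewrite invfM invrK.
    have : (1 : R) <= k.+1%:R by rewrite ler1n.
    by move: (k.+1%:R) => x x1; nra.
  have := hC k.+1%:R; have := hC (- k.+1%:R); rewrite sqrrN => hm hp.
  apply: le_trans (ler_normB _ _) _.
  have he := ler_wpM2l C0 e; apply: le_trans (lerD hp hm) _.
  by move: he; rewrite /harmonic /=; move: (expR _) (k.+1%:R^-1 : R) => E h; lra.
- exact: cvg_cst.
- rewrite -[X in _ --> X](mulr0 (4 * C)); apply: cvgMr; exact: cvg_harmonic.
Unshelve. all: by end_near. Qed.

Lemma gauss_moment0 : has_integral mu (fun r : R => r ^+ 0 * gauss_fun r) (Num.sqrt pi).
Proof.
split; first exact: integrable_gauss_momentum.
by under eq_integral do rewrite expr0 mul1r; exact: integralT_gauss.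
Qed.

Lemma continuous_gauss_momentum n : continuous (fun r : R => r ^+ n * gauss_fun r).
Proof. by move=> x; apply: cvgM; [exact: exprn_continuous|exact: continuous_gauss_fun]. Qed.

Lemma is_derive_gauss_fun (x : R) : is_derive x 1 gauss_fun (- (2 * x * gauss_fun x)).
Proof.
rewrite /gauss_fun; apply: is_derive_eq; rewrite /GRing.scale /=; ring.
Qed.

Lemma gauss_moment1 : has_integral mu (fun r : R => r ^+ 1 * gauss_fun r) 0.
Proof.
have h : has_integral mu (fun r : R => - 2 * (r ^+ 1 * gauss_fun r)) 0.
  apply: (@integral_derivative_eq0 gauss_fun).
  - move=> x; have := is_derive_gauss_fun x.
    by rewrite (_ : - 2 * _ = - (2 * x * gauss_fun x)); last by ring.
  - by move=> x; apply: cvgMr; exact: continuous_gauss_momentum.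
  - have := integrableZl measurableT (- 2) (integrable_gauss_momentum 1).
    exact.
  - by have := @gauss_boundary 0; under eq_fun do rewrite !expr0 !mul1r.
have := has_integralZ (- 2)^-1 h; rewrite mulr0; apply: has_integral_ext => r.
by field.
Qed.

(** Integration by parts: the derivative of r^(n+1) e^(-r^2) is (n+1) r^n e^(-r^2) - 2 r^(n+2)
    e^(-r^2), and its integral vanishes. *)
Lemma gauss_momentSS n a : has_integral mu (fun r : R => r ^+ n * gauss_fun r) a ->
  has_integral mu (fun r : R => r ^+ n.+2 * gauss_fun r) (n.+1%:R / 2 * a).
Proof.
move=> hn.
have h : has_integral mu (fun r : R => n.+1%:R * (r ^+ n * gauss_fun r) +
    (- 2) * (r ^+ n.+2 * gauss_fun r)) 0.
  apply: (@integral_derivative_eq0 (fun r => r ^+ n.+1 * gauss_fun r)).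
  - move=> x; have dg := is_derive_gauss_fun x.
    have dX : is_derive x 1 (fun r : R => r ^+ n.+1) (n.+1%:R * x ^+ n).
      have -> : (fun r : R => r ^+ n.+1) = idfun ^+ n.+1 by apply/funext => r; rewrite exprfctE.
      by apply: is_derive_eq; rewrite /GRing.scale /= mulr1.
    rewrite (_ : (fun r => _) = (fun r => r ^+ n.+1) * gauss_fun)//.
    by apply: is_derive_eq; rewrite /GRing.scale /= !exprS; ring.
  - move=> x; apply: cvgD; apply: cvgMr; exact: continuous_gauss_momentum.
  - have i1 := integrableZl measurableT n.+1%:R (integrable_gauss_momentum n).
    have i2 := integrableZl measurableT (- 2) (integrable_gauss_momentum n.+2).
    exact: (integrableD measurableT i1 i2).
  - exact: gauss_boundary.
have := has_integralZ (- 2^-1) (has_integralD h (has_integralZ (- n.+1%:R) hn)).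
have -> : - 2^-1 * (0 + - n.+1%:R * a) = n.+1%:R / 2 * a by field.
by apply: has_integral_ext => r; field.
Qed.

End gaussian_moments.

(** * From Gaussian integrals on the line to expectations *)

Section normal_change_of_variables.
Context {R : realType} (m s : R).
Local Notation mu := (@lebesgue_measure R).

(** [normal_pdf m s] and the Radon-Nikodym derivative of [normal_prob m s] have the same integral
    over every measurable set, so they agree almost everywhere. *)
Lemma ge0_integral_normal_prob (f : R -> \bar R) : measurable_fun setT f ->
  (forall x, 0 <= f x)%E ->
  (\int[normal_prob m s]_x f x = \int[mu]_x (f x * (normal_pdf m s x)%:E))%E.
Proof.
move=> mf f0.
have dom : normal_prob m s `<< mu by exact: normal_prob_dominates.
rewrite -(Radon_Nikodym_SigmaFinite.change_of_variables dom)//.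
have mpdf : measurable_fun setT (fun x => (normal_pdf m s x)%:E).
  by apply/measurable_EFinP; exact: measurable_normal_pdf.
have iRN := Radon_Nikodym_SigmaFinite.f_integrable dom.
apply: ae_eq_integral => //.
- by apply: emeasurable_funM => //; exact: measurable_int iRN.
- exact: emeasurable_funM.
apply: ae_eqe_mul2l.
apply: integral_ae_eq => // A _ mA.
by rewrite -Radon_Nikodym_SigmaFinite.f_integral.
Qed.
End normal_change_of_variables.

Section normal_moment.
Context {d} {T : measurableType d} {R : realType} (P : probability T R).
Local Notation mu := (@lebesgue_measure R).

Lemma normal_pdf_half (x : R) :
  normal_pdf 0 (Num.sqrt 2^-1) x = (Num.sqrt pi)^-1 * gauss_fun x.
Proof.
have s0 : Num.sqrt (2^-1 : R) != 0 by rewrite sqrtr_eq0 -ltNge invr_gt0.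
rewrite normal_pdfE//= /normal_peak /normal_fun /gauss_fun sqr_sqrtr ?invr_ge0//.
have -> : (2^-1 : R) *+ 2 = 1 by rewrite -[LHS]mulr_natr mulVf ?pnatr_eq0.
rewrite subr0 divr1; congr (_ ^-1 * _).
by congr Num.sqrt; rewrite -[LHS]mulr_natr; field.
Qed.

(** Variance 1/2 makes the density e^(-x^2) / sqrt(pi), which accounts for the factor [Num.sqrt pi]
    in the hypothesis. *)
Lemma has_integral_normal (U : T -> R) (phi : R -> R) (a : R) :
  measurable_fun setT U ->
  (forall B, measurable B -> P (U @^-1` B) = normal_prob 0 (Num.sqrt 2^-1) B) ->
  measurable_fun setT phi ->
  has_integral mu (fun r => phi r * gauss_fun r) (Num.sqrt pi * a) ->
  has_integral P (fun w => phi (U w)) a.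
Proof.
move=> mU hU mphi [iphi ephi].
have mU' : measurable_fun setT (U : T -> measurableTypeR R) by exact: mU.
pose U' : {mfun T >-> measurableTypeR R} := HB.pack U (isMeasurableFun.Build _ _ _ _ _ mU').
have sp : Num.sqrt (pi : R) != 0 by rewrite sqrtr_eq0 -ltNge pi_gt0.
have key (f : R -> \bar R) : measurable_fun setT f -> (forall x, 0 <= f x)%E ->
    (\int[P]_w f (U w) = (Num.sqrt pi)^-1%:E * \int[mu]_x (f x * (gauss_fun x)%:E))%E.
  move=> mf f0.
  transitivity (\int[distribution P U']_x f x)%E.
    by rewrite ge0_integral_distribution.
  transitivity (\int[normal_prob 0 (Num.sqrt 2^-1)]_x f x)%E.
    by apply: eq_measure_integral => A mA _; exact: hU.
  rewrite ge0_integral_normal_prob// -ge0_integralZl//=.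
  - by apply: eq_integral => x _; rewrite normal_pdf_half EFinM muleCA.
  - apply: emeasurable_funM => //; apply/measurable_EFinP; exact: measurable_gauss_fun.
  - by move=> x _; apply: mule_ge0 => //; rewrite lee_fin; exact: gauss_fun_ge0.
have mphi' : measurable_fun setT (EFin \o phi) by exact/measurable_EFinP.
have intU : P.-integrable setT (EFin \o (fun w => phi (U w))).
  apply/integrableP; split; first exact/measurable_EFinP/measurableT_comp.
  rewrite (key (fun x => `|phi x|%:E)%E)//; last first.
    by apply/measurable_EFinP; apply: measurableT_comp => //; exact: normr_measurable.
  apply: lte_mul_pinfty => //.
  move/integrableP : iphi => [_]; congr (_ < _)%E; apply: eq_integral => x _ /=.
  by rewrite normrM (ger0_norm (gauss_fun_ge0 _)) EFinM.
split=> //.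
(* [key] treats nonnegative integrands, so the signed one is split into positive and negative parts,
   each carried over separately and recombined. *)
transitivity (\int[P]_w ((EFin \o phi)^\+ \o U) w - \int[P]_w ((EFin \o phi)^\- \o U) w)%E.
  by rewrite -funepos_comp -funeneg_comp -integralE.
rewrite (key (EFin \o phi)^\+%E) ?(key (EFin \o phi)^\-%E)//; last 2 first.
  exact: measurable_funeneg.
  exact: measurable_funepos.
have Ep : (\int[mu]_x ((EFin \o phi)^\+ x * (gauss_fun x)%:E) =
    \int[mu]_x (EFin \o (fun r => phi r * gauss_fun r)%R)^\+ x)%E.
  apply: eq_integral => x _; rewrite !funeposE /= -!EFin_max -EFinM.
  by rewrite maxr_pMl ?gauss_fun_ge0// mul0r.
have En : (\int[mu]_x ((EFin \o phi)^\- x * (gauss_fun x)%:E) =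
    \int[mu]_x (EFin \o (fun r => phi r * gauss_fun r)%R)^\- x)%E.
  apply: eq_integral => x _; rewrite !funenegE /= -!EFin_max -EFinM.
  by rewrite maxr_pMl ?gauss_fun_ge0// mul0r mulNr.
rewrite Ep En -muleBr//; last first.
  apply: fin_num_adde_defl; rewrite fin_numN.
  exact: integrable_neg_fin_num.
by rewrite -integralE ephi -EFinM mulrA mulVf// mul1r.
Qed.
End normal_moment.

(** * Smooth functions *)

Section measurable_continuous_row.
Context {d'} {T : measurableType d'} {R : realType} {n : nat}.

Lemma measurable_floor_cell (g : T -> R) (m : int) : measurable_fun setT g ->
  measurable [set w | Num.floor (g w) = m].
Proof.
move=> mg; rewrite (_ : [set w | _] = g @^-1` `[m%:~R, (m + 1)%:~R[%classic).
  by rewrite -[X in measurable X]setTI; apply: mg.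
apply/seteqP; split=> w /=; rewrite in_itv /=.
  by move=> <-; exact: floor_itv.
exact: floor_def.
Qed.

(* [h \o X] is the pointwise limit of [h] applied to [X] rounded to a grid; the
   rounded map takes countably many values. *)
Lemma measurable_continuous_row (h : 'rV[R]_n -> R) (X : T -> 'rV[R]_n) :
  continuous h -> (forall j, measurable_fun setT (fun w => X w 0 j)) ->
  measurable_fun setT (h \o X).
Proof.
move=> ch mX.
pose z k w : 'rV[int]_n := \row_j Num.floor (k.+1%:R * X w 0 j).
pose q k (v : 'rV[int]_n) : 'rV[R]_n := \row_j ((v 0 j)%:~R / k.+1%:R).
apply: (@measurable_fun_cvg _ _ _ _ (fun k w => h (q k (z k w)))) => [k|w _].
  move=> _ B mB; rewrite setTI.
  rewrite (_ : _ @^-1` _ = \bigcup_(v : 'rV[int]_n)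
     ([set w | z k w = v] `&` [set w | B (h (q k v))])); last first.
    apply/seteqP; split=> w /=; first by move=> Bw; exists (z k w).
    by move=> [v _ [<-]].
  apply: countable_bigcupT_measurable => // v.
  have [Bv|nBv] := pselect (B (h (q k v))); last first.
    by rewrite (_ : [set _ | B _] = set0) ?setI0//; apply/seteqP; split.
  rewrite (_ : [set _ | B _] = setT) ?setIT; last by apply/seteqP; split.
  rewrite (_ : [set _ | _] = \bigcap_(j in [set: 'I_n])
      [set w | Num.floor (k.+1%:R * X w 0 j) = v 0 j]); last first.
    apply/seteqP; split=> w /=; first by move=> <- j _ /=; rewrite mxE.
    by move=> H; apply/rowP => j; rewrite mxE; exact: H.
  apply: fin_bigcap_measurable => // j _.
  by apply: measurable_floor_cell; exact: measurable_funM.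
apply: continuous_cvg; first exact: ch.
apply/cvgrPdist_le => e e0; near=> k.
rewrite /Num.Def.normr /= mx_normrE; apply/bigmax_leP; split=> [|[i j] _ /=].
  exact: ltW.
rewrite ord1 !mxE.
have k0 : 0 < (k.+1%:R : R) by rewrite ltr0n.
have := floor_itv (k.+1%:R * X w 0 j) => /andP[h1 h2].
have ke : k.+1%:R^-1 <= e.
  near: k; apply: filterS (near_infty_natSinv_lt (PosNum e0)) => k; exact: ltW.
apply: le_trans ke.
rewrite -[leRHS]mul1r ler_pdivlMr// -[X in _ * X](gtr0_norm k0) -normrM.
rewrite mulrBl divfK ?gt_eqF// ler_norml.
move: h2; rewrite intrD; rewrite mulrC in h1 *; move: (_%:~R) h1 => y h1 h2; lra.
Unshelve. all: by end_near. Qed.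

End measurable_continuous_row.

(** * Inner product and squared Euclidean norm *)

Section euclidean.
Context {R : realType} {n : nat}.
Implicit Types u v x y h : 'rV[R]_n.

Definition dot u v : R := \sum_i u 0 i * v 0 i.
Definition sqn u : R := \sum_i u 0 i ^+ 2.

Lemma sqn_ge0 u : 0 <= sqn u.
Proof. by apply: sumr_ge0 => i _; exact: sqr_ge0. Qed.

Lemma enorm_sqr u : enorm u ^+ 2 = sqn u.
Proof. by rewrite sqr_sqrtr// sqn_ge0. Qed.

Lemma sqnZ c u : sqn (c *: u) = c ^+ 2 * sqn u.
Proof. by rewrite /sqn mulr_sumr; apply: eq_bigr => i _; rewrite mxE exprMn. Qed.

Lemma dotC u v : dot u v = dot v u.
Proof. by apply: eq_bigr => i _; rewrite mulrC. Qed.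

Lemma dotZr c u v : dot u (c *: v) = c * dot u v.
Proof. by rewrite /dot mulr_sumr; apply: eq_bigr => i _; rewrite mxE mulrCA. Qed.

Lemma dotBl u v x : dot (u - v) x = dot u x - dot v x.
Proof. by rewrite /dot -sumrB; apply: eq_bigr => i _; rewrite !mxE mulrBl. Qed.

(** In each coordinate the difference of the two sides is (c b - a)^2 / (2c). *)
Lemma dot_young (c : R) u v : 0 < c -> dot u v <= (c * sqn v + sqn u / c) / 2.
Proof.
move=> c0; rewrite /dot /sqn mulr_sumr mulr_suml -big_split mulr_suml/=.
apply: ler_sum => i _; move: (u 0 i) (v 0 i) => a b.
rewrite -subr_ge0 (_ : _ - _ = (c * b - a) ^+ 2 / (2 * c)); last by field; rewrite gt_eqF.
by rewrite divr_ge0 ?sqr_ge0// mulr_ge0// ltW.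
Qed.

End euclidean.

(** * Consequences of L-smoothness *)

Section smooth.
Context {R : realType} {n : nat}.
Variables (f : 'rV[R]_n -> R) (L : R).
Hypotheses (L0 : 0 < L) (fL : Lsmooth L f).
Implicit Types x h : 'rV[R]_n.

Lemma Lsmooth_sqn x y : sqn (grad f x - grad f y) <= L ^+ 2 * sqn (x - y).
Proof.
rewrite -!enorm_sqr -exprMn; case: fL => _ /(_ x y) H.
by rewrite lerXn2r// nnegrE ?mulr_ge0 ?sqrtr_ge0// ltW.
Qed.

Lemma derive_dot x h : 'D_h f x = dot (grad f x) h.
Proof.
have df : differentiable f x by case: fL.
rewrite deriveE// {1}(row_sum_delta h) linear_sum/=.
by apply: eq_bigr => i _; rewrite linearZ/= mxE deriveE//= mulrC.
Qed.

Lemma is_derive_line x h (s : R) :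
  is_derive s 1 (fun s => f (x + s *: h)) (dot (grad f (x + s *: h)) h).
Proof.
have df : derivable f (x + s *: h) h by apply: diff_derivable; case: fL.
have E : (fun k : R => k^-1 *: (f (x + (k *: 1 + s) *: h) - f (x + s *: h))) =
  (fun k : R => k^-1 *: (f (k *: h + (x + s *: h)) - f (x + s *: h))).
  by apply/funext => k; congr (_ *: (f _ - _)); rewrite scalerDl addrCA /GRing.scale /= mulr1.
apply: DeriveDef; first by rewrite /derivable E.
by rewrite -derive_dot /derive E.
Qed.

(* Young's inequality with weight [L * s] replaces Cauchy-Schwarz when bounding
   the derivative along the segment; [e] is a sign. *)
Lemma descent_signed (e : R) x h : e ^+ 2 = 1 ->
  e * (f (x + h) - f x - dot (grad f x) h) <= L / 2 * sqn h.
Proof.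
move=> e1.
(* [psi] has nonpositive derivative on the open unit interval, and the claim is exactly
   [psi 1 <= psi 0]. *)
pose psi (s : R) := e * (f (x + s *: h) - s * dot (grad f x) h) - L / 2 * sqn h * s ^+ 2.
have dpsi (s : R) : is_derive s 1 psi
    (e * dot (grad f (x + s *: h) - grad f x) h - L * s * sqn h).
  have dl := is_derive_line x h s.
  rewrite (_ : psi = (e \*o (fun s => f (x + s *: h)) +
    (- (e * dot (grad f x) h)) \*o (id : R -> R)) +
    (- (L / 2 * sqn h)) \*o ((id : R -> R) ^+ 2)); last first.
    by apply/funext => r; rewrite /psi !fctE /=; ring.
  apply: is_derive_eq; rewrite /GRing.scale /= dotBl. by rewrite expr1 !mulr1; move: (dot _ h) (dot _ h) (sqn h) => a b c; field.
have := @ler0_derive1_nincr R psi 0 1 _ _ _ 0 1.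
have -> : psi 0 = e * f x.
  by rewrite /psi scale0r addr0 mul0r subr0 expr0n mulr0 subr0.
have -> : psi 1 = e * (f (x + h) - dot (grad f x) h) - L / 2 * sqn h.
  by rewrite /psi scale1r mul1r expr1n mulr1.
move=> H; suff : e * (f (x + h) - dot (grad f x) h) - L / 2 * sqn h <= e * f x by lra.
apply: H => //.
- move=> s; rewrite in_itv/= => /andP[s0 _]; rewrite derive1E.
  have [_ ->] := dpsi s.
  have Ls : 0 < L * s by rewrite mulr_gt0.
  have hs : sqn (e *: (grad f (x + s *: h) - grad f x)) <= (L * s) ^+ 2 * sqn h.
    rewrite sqnZ e1 mul1r; apply: (le_trans (Lsmooth_sqn _ _)).
    by rewrite addrAC subrr add0r sqnZ exprMn mulrA.
  rewrite subr_le0 (_ : e * dot _ _ = dot (e *: (grad f (x + s *: h) - grad f x)) h); last first.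
    by rewrite dotC [in RHS]dotC dotZr.
  apply: le_trans (dot_young _ h Ls) _; rewrite ler_pdivrMr// mulrDr mulr1 lerD2l.
  by rewrite ler_pdivrMr// mulrAC -expr2.
- apply: continuous_subspaceT => s.
  by apply/differentiable_continuous/derivable1_diffP; case: (dpsi s).
Qed.

Lemma descent_abs x h :
  `|f (x + h) - f x - dot (grad f x) h| <= L / 2 * sqn h.
Proof.
rewrite ler_norml; apply/andP; split.
  by have := @descent_signed (-1) x h (etrans (sqrrN 1) (expr1n _ 2)); lra.
by have := @descent_signed 1 x h (expr1n _ _); lra.
Qed.

(** A gradient step of length factor 1/L lowers [f] by at least |grad f|^2 / (2L), and the value
    reached is still at least [m]. *)
Lemma sqn_grad_le (m : R) x : (forall y, m <= f y) ->
  sqn (grad f x) <= 2 * L * (f x - m).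
Proof.
move=> hm; have := hm (x + - L^-1 *: grad f x).
have := descent_abs x (- L^-1 *: grad f x); rewrite ler_norml => /andP[_].
rewrite sqnZ dotZr (_ : dot _ _ = sqn (grad f x)) => [H1 H2|]; last first.
  by apply: eq_bigr => i _; rewrite expr2.
move: (sqn _) H1 => g H1.
have : L^-1 * g / 2 <= f x - m.
  have e : L / 2 * ((- L^-1) ^+ 2 * g) = L^-1 * g / 2 by field; rewrite gt_eqF.
  by rewrite e in H1; move: H1 H2; lra.
by rewrite ler_pdivrMr// ler_pdivrMl//; lra.
Qed.

Lemma continuous_smooth : continuous f.
Proof. by move=> x; apply: differentiable_continuous; case: fL. Qed.

Lemma continuous_grad i : continuous (fun x => grad f x 0 i).
Proof.
move=> x; apply/(@cvgrPdist_le _ _ _ _ (nbhs_filter x)) => e e0.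
(* The topology on rows comes from the sup norm, and |v|_2^2 <= n |v|_sup^2. The factor n+1
   dominates sqrt n and keeps the radius well defined when n = 0. *)
have : nbhs x [set y | `|x - y| <= e / (L * n.+1%:R)].
  apply/nbhs_ballP; exists (e / (L * n.+1%:R)); first by rewrite /= divr_gt0// mulr_gt0.
  by move=> y; rewrite mx_norm_ball /ball_ /= => /ltW.
apply: (@filterS _ _ (nbhs_filter x)) => y /= h3.
have h1 : (grad f x 0 i - grad f y 0 i) ^+ 2 <= L ^+ 2 * sqn (x - y).
  apply: le_trans (Lsmooth_sqn x y); rewrite /sqn (bigD1 i)//= !mxE lerDl.
  by apply: sumr_ge0 => j _; exact: sqr_ge0.
have h2 : sqn (x - y) <= n%:R * `|x - y| ^+ 2.
  rewrite /sqn mulr_natl -[X in _ *+ X]card_ord -sumr_const.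
  apply: ler_sum => j _; rewrite -[leLHS]real_normK ?num_real//.
  rewrite lerXn2r ?nnegrE//.
  rewrite {2}/Num.Def.normr /= mx_normrE.
  exact: (le_bigmax _ (fun ij : 'I_1 * 'I_n => `|(x - y) ij.1 ij.2|) (ord0, j)).
have h4 : L * n.+1%:R * `|x - y| <= e by rewrite mulrC -ler_pdivlMr ?mulr_gt0.
apply: le_trans h4; rewrite -ler_sqr ?nnegrE ?mulr_ge0 ?(ltW L0)//.
rewrite real_normK ?num_real//; apply: (le_trans h1).
rewrite -mulrA exprMn ler_pM2l ?exprn_gt0//; apply: (le_trans h2).
rewrite exprMn ler_wpM2r ?sqr_ge0// -natrX ler_nat.
by rewrite (leq_trans (leqnSn n))// -[X in (X <= _)%N]expn1 leq_pexp2l.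
Qed.
End smooth.

(** [Rintegral] sends an infinite integral to 0; here the extended integral is squeezed between two
    finite numbers, so that default never occurs. *)
Lemma Rintegral_sandwich {d} {T : measurableType d} {R : realType}
    (mu : {measure set T -> \bar R}) (l h q : T -> R) (a b : R) :
  has_integral mu l a -> has_integral mu q b ->
  (forall x, l x <= h x <= q x) ->
  a <= Rintegral mu setT h <= b.
Proof.
move=> [_ hl] [_ hq] lhq; rewrite /Rintegral.
have : (a%:E <= \int[mu]_x (h x)%:E)%E.
  by rewrite -hl; apply: le_integral_nomeas => x; rewrite lee_fin; case/andP: (lhq x).
have : (\int[mu]_x (h x)%:E <= b%:E)%E.
  by rewrite -hq; apply: le_integral_nomeas => x; rewrite lee_fin; case/andP: (lhq x).
by case: (\int[mu]_x (h x)%:E)%E => [r| |] //=; rewrite !lee_fin => -> ->.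
Qed.

(** * Upper bound for the Gaussian smoothing *)

Section gsmooth_bound.
Context {R : realType} {n : nat}.
Local Notation mu := (@lebesgue_measure R).

Lemma gauss_quadratic (a b c : R) :
  has_integral mu (fun r => expR (- r ^+ 2) * (a + b * r + c * r ^+ 2))
    (Num.sqrt pi * (a + c / 2)).
Proof.
have h0 := @gauss_moment0 R; have h1 := @gauss_moment1 R.
have := has_integralD (has_integralD (has_integralZ a h0) (has_integralZ b h1))
  (has_integralZ c (gauss_momentSS h0)).
rewrite (_ : a * _ + _ + _ = Num.sqrt pi * (a + c / 2)); last by field.
by apply: has_integral_ext => r; rewrite /gauss_fun expr0 expr1; ring.
Qed.

(** Induction on the coordinates still to be integrated: integrating coordinate i replaces b_i r + q
    r^2 by its Gaussian mean q / 2, and the constant lower bound keeps every iterated integral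
    finite. *)
Lemma gauss_iint_bound (F : 'rV[R]_n -> R) (c A q : R) (b : 'I_n -> R) s v :
  (forall v, c <= F v <= A + \sum_i (b i * v 0 i + q * v 0 i ^+ 2)) -> uniq s ->
  c <= gauss_iint s F v <=
    A + \sum_i (if i \in s then q / 2 else b i * v 0 i + q * v 0 i ^+ 2).
Proof.
move=> hF; elim: s v => [v _|i s IH v /= /andP[nis us]]; first exact: hF.
have sp : 0 < Num.sqrt (pi : R) by rewrite sqrtr_gt0 pi_gt0.
(* [A'] gathers everything independent of coordinate [i], leaving a quadratic polynomial in the
   integration variable. *)
pose A' := A + \sum_(j | j != i) (if j \in s then q / 2 else b j * v 0 j + q * v 0 j ^+ 2).
rewrite (_ : A + _ = A' + q / 2); last first.
  rewrite (bigD1 i)//= mem_head /A' -addrA; congr (_ + _); rewrite addrC; congr (_ + _).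
  by apply: eq_bigr => j ji; rewrite inE (negbTE ji).
have := @Rintegral_sandwich _ (measurableTypeR R) _ mu _ (fun r : R => expR (- r ^+ 2) * gauss_iint s F (setcoord v i r))
  _ _ _ (gauss_quadratic c 0 0) (gauss_quadratic A' (b i) q).
rewrite mul0r addr0 => H.
rewrite ler_pdivlMl// ler_pdivrMl//; apply: H => r.
rewrite !mul0r !addr0 !ler_pM2l ?expR_gt0//.
have /andP[-> /=] := IH (setcoord v i r) us.
congr (_ <= _); rewrite (bigD1 i)//= (negbTE nis) mxE eqxx /A' -2![RHS]addrA; congr (_ + _).
rewrite [RHS]addrC; congr (_ + _).
by apply: eq_bigr => j ji; rewrite mxE (negbTE ji).
Qed.

(** Smoothness bounds [f] above by a quadratic around [x]. Its linear terms average to 0 and each of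
    the n squares to 1/2, which leaves n (L/2) s^2 / 2. *)
Lemma gsmooth_le (f : 'rV[R]_n -> R) (L m s : R) (x : 'rV[R]_n) :
  0 < L -> Lsmooth L f -> (forall y, m <= f y) -> 0 < s ->
  gsmooth f s x <= f x + L * n%:R * s ^+ 2 / 4.
Proof.
move=> L0 fL hm s0; rewrite /gsmooth gt_eqF//.
have hq v : m <= f (x + s *: v) <=
    f x + \sum_i (s * grad f x 0 i * v 0 i + L / 2 * s ^+ 2 * v 0 i ^+ 2).
  rewrite hm /=; have := descent_abs L0 fL x (s *: v); rewrite ler_norml => /andP[_].
  rewrite big_split /= -mulr_sumr dotZr sqnZ.
  rewrite (_ : \sum_(i < n) _ = s * dot (grad f x) v).
    by rewrite -/(sqn v); lra.
  by rewrite /dot mulr_sumr; apply: eq_bigr => i _; rewrite mulrA.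
have /andP[_] := gauss_iint_bound 0 hq (enum_uniq 'I_n).
under eq_bigr do rewrite mem_enum inE.
rewrite sumr_const card_ord -[X in _ <= _ + X -> _]mulr_natr => /le_trans; apply.
by rewrite lerD2l le_eqVlt; apply/orP; left; apply/eqP; field.
Qed.
End gsmooth_bound.

(** * Moments of a Gaussian sample independent of the past *)

Section avoiding.
Context {d} {T : measurableType d} {R : realType} {I : choiceType}.
Variables (P : probability T R) (X : I -> T -> R).
Hypothesis mX : forall i, measurable_fun setT (X i).
Hypothesis indX : mutually_independent P X.

(** Expresses that [Y] is a function of the variables other than [X i], as measurability for the
    sigma-algebra they generate; closure under products is then immediate. *)
Definition avoids (i : I) (Y : T -> R) :=
  measurable_fun setT (Y : g_sigma_algebraType (cylinders_avoiding X i) -> R).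

Lemma avoids_coord i j : i != j -> avoids i (X j).
Proof.
move=> ij _ B mB; rewrite setTI; apply: sub_sigma_algebra.
exists [:: j], (fun=> B); split=> //; first by rewrite inE.
apply/seteqP; split=> w /=; first by move=> h l; rewrite /= inE => /eqP ->.
by apply; rewrite /= inE.
Qed.

Lemma avoidsM i Y Z : avoids i Y -> avoids i Z -> avoids i (fun w => Y w * Z w).
Proof. by move=> hY hZ; exact: measurable_funM. Qed.

Lemma avoidsX i Y k : avoids i Y -> avoids i (fun w => Y w ^+ k).
Proof. by move=> hY; exact: measurable_funX. Qed.

Lemma has_integral_avoidsM i Y (phi : R -> R) a b : avoids i Y ->
  measurable_fun setT phi -> has_integral P Y a ->
  has_integral P (fun w => phi (X i w)) b ->
  has_integral P (fun w => Y w * phi (X i w)) (a * b).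
Proof.
move=> aY mphi; apply: has_integral_indepM => A B mA mB.
rewrite (_ : (fun w => phi (X i w)) @^-1` B = X i @^-1` (phi @^-1` B))//.
apply: (generated_independent mX indX).
  by rewrite -[X in measurable X]setTI; exact: mphi.
by have := aY measurableT A mA; rewrite setTI.
Qed.

End avoiding.

(** Expand the nonnegative sum of (n y_i - S)^2, where S is the sum of the y_i, and divide by n; n =
    0 is treated apart. *)
Lemma sqr_sum_le {R : realType} {n : nat} (y : 'I_n -> R) :
  (\sum_i y i) ^+ 2 <= n%:R * \sum_i y i ^+ 2.
Proof.
case: n y => [|n] y; first by rewrite !big_ord0 expr0n mul0r.
set S := \sum_i y i; have n0 : 0 < (n.+1%:R : R) by rewrite ltr0n.
have : 0 <= \sum_i (n.+1%:R * y i - S) ^+ 2 by apply: sumr_ge0 => i _; exact: sqr_ge0.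
rewrite (eq_bigr (fun i => n.+1%:R ^+ 2 * y i ^+ 2 + (- 2 * n.+1%:R * S) * y i + S ^+ 2)).
  rewrite !big_split/= -2!mulr_sumr sumr_const card_ord -[S ^+ 2 *+ _]mulr_natl -/S.
  rewrite (_ : _ + _ + _ = n.+1%:R * (n.+1%:R * (\sum_i y i ^+ 2) - S ^+ 2)).
    by rewrite pmulr_rge0// subr_ge0.
  by ring.
by move=> i _; ring.
Qed.

(** * Mixed moments of one sample *)

Section gaussian_sample.
Context {d} {T : measurableType d} {R : realType} {I : choiceType}.
Variables (P : probability T R) (X : I -> T -> R).
Hypothesis mX : forall i, measurable_fun setT (X i).
Hypothesis indX : mutually_independent P X.
Hypothesis lawX : forall i (B : set R), measurable B ->
  P (X i @^-1` B) = normal_prob 0 (Num.sqrt 2^-1) B.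

Let mpow k : measurable_fun setT (fun x : R => x ^+ k).
Proof. exact: measurable_funX. Qed.

Let moment k a :
  has_integral (@lebesgue_measure R) (fun r => r ^+ k * gauss_fun r) (Num.sqrt pi * a) ->
  forall i, has_integral P (fun w => X i w ^+ k) a.
Proof. by move=> h i; apply: (has_integral_normal (mX i)) h => //; exact: lawX. Qed.

Let moment1 i : has_integral P (fun w => X i w ^+ 1) 0.
Proof. by apply: moment; rewrite mulr0; exact: gauss_moment1. Qed.

Let moment2 i : has_integral P (fun w => X i w ^+ 2) (1 / 2).
Proof.
apply: moment; have := gauss_momentSS (@gauss_moment0 R).
by congr has_integral; field.
Qed.

Let moment3 i : has_integral P (fun w => X i w ^+ 3) 0.
Proof.
apply: moment; have := gauss_momentSS (@gauss_moment1 R).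
by rewrite !mulr0.
Qed.

Let moment4 i : has_integral P (fun w => X i w ^+ 4) (3 / 4).
Proof.
apply: moment; have := gauss_momentSS (gauss_momentSS (@gauss_moment0 R)).
by congr has_integral; field.
Qed.

Let moment6 i : has_integral P (fun w => X i w ^+ 6) (15 / 8).
Proof.
apply: moment.
have := gauss_momentSS (gauss_momentSS (gauss_momentSS (@gauss_moment0 R))).
by congr has_integral; field.
Qed.

(** Adjoins one power of one coordinate to a factor that avoids it; mixed moments are computed by
    repeating this over distinct coordinates. *)
Let step (H : T -> R) a i k b : avoids X i H -> has_integral P H a ->
  has_integral P (fun w => X i w ^+ k) b ->
  has_integral P (fun w => H w * X i w ^+ k) (a * b).
Proof. by move=> aH hH hb; apply: (has_integral_avoidsM mX indX aH (mpow k)). Qed.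

Variables (n : nat) (ix : 'I_n -> I).
Hypothesis ix_inj : injective ix.
Local Notation u := (fun j => X (ix j)).

Section against.
Variables (H : T -> R) (a : R).
Hypotheses (aH : forall j, avoids X (ix j) H) (hH : has_integral P H a).

Let av j l : l != j -> avoids X (ix j) (X (ix l)).
Proof. by move=> lj; apply: avoids_coord; rewrite (inj_eq ix_inj) eq_sym. Qed.

Lemma has_integral_quadratic i j :
  has_integral P (fun w => H w * (u i w * u j w)) (if i == j then a / 2 else 0).
Proof.
case: eqVneq => [<-|ij].
  have := step (@aH i) hH (moment2 (ix i)); rewrite mul1r.
  by apply: has_integral_ext => w; rewrite expr2.
have h1 := step (@aH i) hH (moment1 (ix i)).
have := step (avoidsM (@aH j) (avoidsX 1 (av ij))) h1 (moment1 (ix j)).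
by rewrite !mulr0; apply: has_integral_ext => w; rewrite !expr1 mulrA.
Qed.

(** When i and j differ, some coordinate occurs to an odd power whatever l is, so the mean is 0. On
    the diagonal it is the fourth moment 3/4 or a product of two second moments. *)
Lemma has_integral_quartic i j l :
  has_integral P (fun w => H w * (u i w * u j w) * u l w ^+ 2)
    (if i == j then (if l == i then 3 / 4 * a else a / 4) else 0).
Proof.
case: eqVneq => [<-|ij].
  case: eqVneq => [->|li].
    have := step (@aH i) hH (moment4 (ix i)); rewrite [a * _]mulrC.
    by apply: has_integral_ext => w; ring.
  have h1 := step (@aH i) hH (moment2 (ix i)).
  have il : i != l by rewrite eq_sym.
  have := step (avoidsM (@aH l) (avoidsX 2 (av il))) h1 (moment2 (ix l)).
  rewrite (_ : a * (1 / 2) * (1 / 2) = a / 4); last by field.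
  by apply: has_integral_ext => w; ring.
have [->|lj] := eqVneq l j.
  have h1 := step (@aH i) hH (moment1 (ix i)).
  have := step (avoidsM (@aH j) (avoidsX 1 (av ij))) h1 (moment3 (ix j)).
  by rewrite !mulr0; apply: has_integral_ext => w; ring.
have [->|li] := eqVneq l i.
  have h1 := step (@aH i) hH (moment3 (ix i)).
  have := step (avoidsM (@aH j) (avoidsX 3 (av ij))) h1 (moment1 (ix j)).
  by rewrite !mulr0; apply: has_integral_ext => w; ring.
have h1 := step (@aH i) hH (moment1 (ix i)).
have il : i != l by rewrite eq_sym.
have h2 := step (avoidsM (@aH l) (avoidsX 1 (av il))) h1 (moment2 (ix l)).
have := step (avoidsM (avoidsM (@aH j) (avoidsX 1 (av ij))) (avoidsX 2 (av lj)))
  h2 (moment1 (ix j)).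
by rewrite !mulr0; apply: has_integral_ext => w; ring.
Qed.

End against.

Let sum_delta2 (e : 'I_n -> 'I_n -> R) i :
  \sum_j (if i == j then e i j else 0) = e i i.
Proof. by rewrite -big_mkcond (eq_bigl (pred1 i)) ?big_pred1_eq// => j; rewrite eq_sym. Qed.

Let sum_delta_cst (b c : R) (i : 'I_n) :
  \sum_l (if l == i then b else c) = b - c + n%:R * c.
Proof.
rewrite (bigD1 i)//= eqxx -addrA; congr (_ + _).
have -> : n%:R * c = \sum_(l < n) c by rewrite sumr_const card_ord mulr_natl.
rewrite [in RHS](bigD1 i)//= addKr.
by apply: eq_bigr => l /negbTE ->.
Qed.

Let sample w : 'rV[R]_n := \row_j u j w.

Section gradient.
Variables (g : T -> 'rV[R]_n) (e : 'I_n -> 'I_n -> R).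
Hypotheses (ag : forall i j, avoids X (ix j) (fun w => g w 0 i))
  (hg : forall i j, has_integral P (fun w => g w 0 i * g w 0 j) (e i j)).

Let agg i j l : avoids X (ix l) (fun w => g w 0 i * g w 0 j).
Proof. exact: avoidsM. Qed.

Lemma has_integral_sqn : has_integral P (fun w => sqn (g w)) (\sum_i e i i).
Proof.
by apply: has_integral_sum => i _; apply: has_integral_ext (hg i i) => w; rewrite expr2.
Qed.

Lemma has_integral_dot2 :
  has_integral P (fun w => dot (g w) (sample w) ^+ 2) ((\sum_i e i i) / 2).
Proof.
have := has_integral_sum (p := xpredT) (index_enum 'I_n) (fun i _ =>
  has_integral_sum (p := xpredT) (index_enum 'I_n)
  (fun j _ => has_integral_quadratic (@agg i j) (hg i j) i j)).
rewrite (eq_bigr (fun i => e i i / 2)); last first.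
  by move=> i _; exact: (sum_delta2 (fun i j => e i j / 2)).
rewrite -mulr_suml; apply: has_integral_ext => w.
rewrite expr2 /dot big_distrlr/=; apply: eq_bigr => i _; apply: eq_bigr => j _.
by rewrite !mxE; ring.
Qed.

(** Only diagonal pairs survive, and summing over the third index gives 3/4 + (n-1)/4 = (n+2)/4 for
    each. *)
Lemma has_integral_dot2_sqn :
  has_integral P (fun w => dot (g w) (sample w) ^+ 2 * sqn (sample w))
    ((n%:R + 2) / 4 * \sum_i e i i).
Proof.
have := has_integral_sum (p := xpredT) (index_enum 'I_n) (fun i _ =>
  has_integral_sum (p := xpredT) (index_enum 'I_n)
  (fun j _ => has_integral_sum (p := xpredT) (index_enum 'I_n)
    (fun l _ => has_integral_quartic (@agg i j) (hg i j) i j l))).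
rewrite (eq_bigr (fun i => (n%:R + 2) / 4 * e i i)); last first.
  move=> i _; rewrite -[RHS](sum_delta2 (fun i j => (n%:R + 2) / 4 * e i j)).
  apply: eq_bigr => j _; case: eqVneq => [<-|_]; last by rewrite big1.
  by rewrite sum_delta_cst; field.
rewrite -mulr_sumr; apply: has_integral_ext => w.
rewrite expr2 /dot big_distrlr/= mulr_suml; apply: eq_bigr => i _.
rewrite mulr_suml; apply: eq_bigr => j _.
by rewrite /sqn mulr_sumr; apply: eq_bigr => l _; rewrite !mxE; ring.
Qed.

End gradient.

Lemma has_integral_sqn2 :
  has_integral P (fun w => sqn (sample w) ^+ 2) (n%:R * (n%:R + 2) / 4).
Proof.
have a1 j : avoids X (ix j) (fun=> 1 : R) by exact: measurable_cst.
have := has_integral_sum (p := xpredT) (index_enum 'I_n) (fun i _ =>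
  has_integral_sum (p := xpredT) (index_enum 'I_n)
  (fun l _ => has_integral_quartic a1 (has_integral_cst P 1) i i l)).
rewrite (eq_bigr (fun=> (n%:R + 2) / 4)); last first.
  by move=> i _; rewrite eqxx sum_delta_cst; field.
rewrite sumr_const card_ord -[_ *+ n]mulr_natl mulrA; apply: has_integral_ext => w.
rewrite expr2 /sqn big_distrlr/=; apply: eq_bigr => i _; apply: eq_bigr => l _.
by rewrite !mxE; ring.
Qed.

(** Bounding one factor |u|^4 by n times the sum of the u_j^4 leaves only products over pairs. These
    have mean 15/8 on the diagonal and (1/2)(3/4) = 3/8 off it. *)
Lemma has_integral_sqn3_ub : exists Z : T -> R,
  has_integral P Z (n%:R ^+ 2 * (3 * n%:R + 12) / 8) /\
  forall w, sqn (sample w) ^+ 3 <= Z w.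
Proof.
exists (fun w => n%:R * \sum_i \sum_j u i w ^+ 2 * u j w ^+ 4); split.
  have h i j : has_integral P (fun w => u i w ^+ 2 * u j w ^+ 4)
      (if j == i then 15 / 8 else 3 / 8).
    case: eqVneq => [->|ji].
      by apply: has_integral_ext (moment6 (ix i)) => w; rewrite -exprD.
    have av : avoids X (ix j) (X (ix i)) by apply: avoids_coord; rewrite (inj_eq ix_inj).
    have := step (avoidsX 2 av) (moment2 (ix i)) (moment4 (ix j)).
    by congr has_integral; field.
  have := has_integralZ n%:R (has_integral_sum (p := xpredT) (index_enum 'I_n) (fun i _ =>
    has_integral_sum (p := xpredT) (index_enum 'I_n) (fun j _ => h i j))).
  rewrite (eq_bigr (fun=> (3 * n%:R + 12) / 8)).
    by rewrite sumr_const card_ord -[_ *+ n]mulr_natl; congr has_integral; ring.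
  by move=> i _; rewrite sum_delta_cst; field.
move=> w.
rewrite (_ : sqn (sample w) ^+ 3 = sqn (sample w) * (\sum_i u i w ^+ 2) ^+ 2); last first.
  rewrite [LHS]exprS; congr (_ * _ ^+ 2).
  by apply: eq_bigr => i _; rewrite mxE.
apply: (le_trans (ler_wpM2l (sqn_ge0 _) (sqr_sum_le _))).
rewrite mulrCA /sqn big_distrlr/= le_eqVlt; apply/orP; left; apply/eqP.
congr (_ * _); apply: eq_bigr => i _; apply: eq_bigr => j _.
by rewrite !mxE; ring.
Qed.

End gaussian_sample.

(** * Descent along the iteration *)

Section iterate.
Context {R : realType} {n : nat} (f : 'rV[R]_n -> R) (L : R).
Hypotheses (L0 : 0 < L) (fL : Lsmooth L f).
Implicit Types x u : 'rV[R]_n.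

(** Before division by [s], the central scheme adds two one-sided errors and the forward scheme
    doubles one; each error is at most (L/2) s^2 |u|^2, so both totals coincide. *)
Lemma fdiff_expansion central s x u : 0 < s ->
  `|fdiff central f s x u - 2 * dot (grad f x) u| <= L * s * sqn u.
Proof.
move=> s0; have := descent_abs L0 fL x (s *: u).
have := descent_abs L0 fL x (- s *: u).
rewrite !sqnZ !dotZr sqrrN scaleNr !ler_norml /fdiff.
move: (dot _ u) (sqn u) (f (x + _)) (f (x - _)) (f x) => p q fp fm f0.
move=> /andP[h1 h2] /andP[h3 h4].
have s1 : s != 0 by rewrite gt_eqF.
case: central.
  rewrite (_ : _ / s - _ = (fp - fm - 2 * s * p) / s); last by field.
  by rewrite ler_pdivlMr// ler_pdivrMr//; apply/andP; split; lra.
rewrite (_ : _ / (s / 2) - _ = (2 * (fp - f0) - 2 * s * p) / s); last by field.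
by rewrite ler_pdivlMr// ler_pdivrMr//; apply/andP; split; lra.
Qed.

(* Obtained from delta = 2 p + r with - r p <= p^2 / 2 + r^2 / 2 and
   delta^2 <= 8 p^2 + 2 r^2. *)
Definition step_bound (t s : R) x u : R :=
  - (3 / 2) * t * dot (grad f x) u ^+ 2 + t * L ^+ 2 * s ^+ 2 / 2 * sqn u ^+ 2
  + 4 * L * t ^+ 2 * (dot (grad f x) u ^+ 2 * sqn u) + L ^+ 3 * t ^+ 2 * s ^+ 2 * sqn u ^+ 3.

Lemma sample_step central t s x u : 0 < s -> 0 < t ->
  - t * (fdiff central f s x u * dot (grad f x) u) +
   L / 2 * t ^+ 2 * (fdiff central f s x u ^+ 2 * sqn u) <= step_bound t s x u.
Proof.
move=> s0 t0; have := fdiff_expansion central x u s0; have := sqn_ge0 u.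
rewrite /step_bound; move: (fdiff _ _ _ _ _) (dot _ _) (sqn u) => D p q q0.
have [r ->] : exists r, D = 2 * p + r by exists (D - 2 * p); lra.
rewrite (_ : 2 * p + r - _ = r); last by ring.
move=> hr.
have r2 : r ^+ 2 <= L ^+ 2 * s ^+ 2 * q ^+ 2.
  rewrite -real_normK ?num_real// -!exprMn lerXn2r ?nnegrE ?mulr_ge0//.
  - exact: ltW.
  - exact: ltW.
(* The two gaps are (p + r)^2 / 2 here and (2p - r)^2 in [h2]. *)
have h1 : - ((2 * p + r) * p) <= - (3 / 2) * p ^+ 2 + r ^+ 2 / 2.
  by have := sqr_ge0 (p + r); rewrite -subr_ge0; lra.
have h2 : (2 * p + r) ^+ 2 <= 8 * p ^+ 2 + 2 * r ^+ 2.
  by have := sqr_ge0 (2 * p - r); rewrite -subr_ge0; lra.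
have h3 := ler_wpM2l (ltW t0) h1.
have h4 : L / 2 * t ^+ 2 * ((2 * p + r) ^+ 2 * q) <=
    L / 2 * t ^+ 2 * ((8 * p ^+ 2 + 2 * r ^+ 2) * q).
  apply: ler_wpM2l; first by rewrite mulr_ge0 ?sqr_ge0// divr_ge0// ltW.
  exact: ler_wpM2r.
have h5 := ler_wpM2l (ltW t0) r2.
have h6 : L * t ^+ 2 * q * r ^+ 2 <= L * t ^+ 2 * q * (L ^+ 2 * s ^+ 2 * q ^+ 2).
  by apply: ler_wpM2l => //; rewrite !mulr_ge0 ?sqr_ge0// ltW.
lra.
Qed.

(** In the descent inequality the inner product with the estimator is exactly an average over
    samples, and convexity bounds its squared norm by such an average; [sample_step] then acts on
    each sample. *)
Lemma gest_step central (N : nat) t s x (us : 'I_N -> 'rV[R]_n) :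
  (0 < N)%N -> 0 < s -> 0 < t ->
  f (x - t *: gest central f s x us) <=
    f x + N%:R^-1 * \sum_(i < N) step_bound t s x (us i).
Proof.
move=> N0 s0 t0; set g := gest _ _ _ _ _.
have NR : 0 < (N%:R : R) by rewrite ltr0n.
have := descent_abs L0 fL x (- t *: g); rewrite ler_norml => /andP[_].
rewrite dotZr sqnZ sqrrN scaleNr => hd.
pose D i := fdiff central f s x (us i).
have hdot : dot (grad f x) g = N%:R^-1 * \sum_i D i * dot (grad f x) (us i).
  rewrite /g /gest dotZr; congr (_ * _); rewrite /dot.
  under [RHS]eq_bigr do rewrite mulr_sumr.
  rewrite exchange_big /=; apply: eq_bigr => j _; rewrite summxE mulr_sumr.
  by apply: eq_bigr => i _; rewrite [(_ *: us i) 0 j]mxE mulrCA.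
have hsq : sqn g <= N%:R^-1 * \sum_i D i ^+ 2 * sqn (us i).
  rewrite /g /gest sqnZ.
  have : sqn (\sum_i D i *: us i) <= N%:R * \sum_i D i ^+ 2 * sqn (us i).
    rewrite {1}/sqn; under [X in _ <= _ * X]eq_bigr do rewrite /sqn mulr_sumr.
    rewrite exchange_big /= mulr_sumr; apply: ler_sum => j _; rewrite summxE.
    apply: (le_trans (sqr_sum_le _)); apply: ler_wpM2l => //.
    by apply: ler_sum => i _; rewrite mxE exprMn.
  move=> /(ler_wpM2l (sqr_ge0 N%:R^-1)) /le_trans; apply.
  by rewrite mulrA expr2 mulfVK ?gt_eqF.
have : \sum_i (- t * (D i * dot (grad f x) (us i)) +
     L / 2 * t ^+ 2 * (D i ^+ 2 * sqn (us i))) <= \sum_i step_bound t s x (us i).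
  by apply: ler_sum => i _; exact: sample_step.
have Ni : 0 <= N%:R^-1 :> R by rewrite invr_ge0.
move=> /(ler_wpM2l Ni); rewrite big_split/= -!mulr_sumr mulrDr => h.
have h' : L / 2 * t ^+ 2 * sqn g <=
  L / 2 * t ^+ 2 * (N%:R^-1 * \sum_i D i ^+ 2 * sqn (us i)).
  by apply: ler_wpM2l => //; rewrite mulr_ge0 ?sqr_ge0// divr_ge0// ltW.
move: hd h h'; rewrite hdot; lra.
Qed.

Lemma measurable_grad_comp d' (T' : measurableType d') (X : T' -> 'rV[R]_n) i :
  (forall j, measurable_fun setT (fun w => X w 0 j)) ->
  measurable_fun setT (fun w => grad f (X w) 0 i).
Proof.
exact: (measurable_continuous_row (h := fun x => grad f x 0 i) (continuous_grad L0 fL (i := i))).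
Qed.

(** The measurable space is arbitrary and only samples of steps before [K] are constrained. Choosing
    the sigma-algebra that avoids a sample coordinate of step [K] makes the iterate independent of
    it. *)
Lemma measurable_zo_iter d' (T' : measurableType d') central (N : nat) (t : R)
    (sigma : nat -> R) x0 (U : nat -> 'I_N -> 'I_n -> T' -> R) (K : nat) :
  (forall k i j, (k < K)%N -> measurable_fun setT (U k i j)) ->
  forall j, measurable_fun setT (fun w =>
    zo_iter central f t sigma x0 (fun k i => \row_j U k i j w) K 0 j).
Proof.
elim: K => [|K IH] mU j /=; first exact: measurable_cst.
have mX j' := IH (fun k i j kK => mU k i j (ltnW kK)) j'.
pose X w := zo_iter central f t sigma x0 (fun k i => \row_j U k i j w) K.
have mu i j' : measurable_fun setT (U K i j') by exact: mU.
have mf (c : R) i : measurable_fun setT (fun w => f (X w + c *: \row_j U K i j w)).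
  apply: (measurable_continuous_row (X := fun w => X w + c *: \row_j U K i j w)).
    exact: continuous_smooth fL.
  move=> j'; under eq_fun do rewrite !mxE.
  by apply: measurable_funD => //; exact: measurable_funM.
have mf0 : measurable_fun setT (fun w => f (X w)).
  by apply: (measurable_continuous_row (X := X)) => //; exact: continuous_smooth fL.
under eq_fun do rewrite !mxE.
apply: measurable_funB => //; apply: measurable_funM => //; apply: measurable_funM => //.
under eq_fun do rewrite summxE.
apply: measurable_sum => i.
under eq_fun do rewrite !mxE.
apply: measurable_funM => //.
rewrite /fdiff; case: {1}central.
  apply: measurable_funM => //; apply: measurable_funB; first exact: mf.
  by under eq_fun do rewrite -scaleNr; exact: mf.
by apply: measurable_funM => //; apply: measurable_funB => //; exact: mf.
Qed.

End iterate.

(** * Descent in expectation and summation over the steps *)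

Section descent_in_expectation.
Context {R : realType} {n : nat} (f : 'rV[R]_n -> R) (L m : R).
Hypotheses (L0 : 0 < L) (fL : Lsmooth L f) (fm : forall x, m <= f x).
Variables (sigma : nat -> R) (N : nat) (t : R) (x0 : 'rV[R]_n) (central : bool).
Hypotheses (sigma0 : forall k, (0 < k)%N -> 0 < sigma k) (N0 : (0 < N)%N).
Hypotheses (t0 : 0 < t) (tL : t < (2 * L * (n + 4)%:R)^-1).
Context {d} {T : measurableType d} (P : probability T R).
Variable U : nat -> 'I_N -> 'I_n -> T -> R.
Hypothesis mU : forall k i j, measurable_fun setT (U k i j).
Hypothesis lawU : forall k i j (B : set R), measurable B ->
  P (U k i j @^-1` B) = normal_prob 0 (Num.sqrt 2^-1) B.
Local Notation V := (fun l : nat * 'I_N * 'I_n => U l.1.1 l.1.2 l.2).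
Hypothesis indU : mutually_independent P V.

Let X k w := zo_iter central f t sigma x0 (fun k i => \row_j U k i j w) k.
Let F k := Rintegral P setT (fun w => f (X k w)).
Let A k := Rintegral P setT (fun w => sqn (grad f (X k w))).

Let tL4 : L * t * (n%:R + 4) <= 1 / 2.
Proof.
have p : 0 < 2 * L * (n + 4)%:R by rewrite !mulr_gt0// ltr0n addn4.
by move: tL; rewrite -[ltRHS]mul1r ltr_pdivlMr// natrD; lra.
Qed.

Let mX k j : measurable_fun setT (fun w => X k w 0 j).
Proof. exact: (measurable_zo_iter fL central t sigma x0 (fun k i j _ => mU k i j)). Qed.

Let mfX k : measurable_fun setT (fun w => f (X k w)).
Proof.
apply: (measurable_continuous_row (h := f) (X := X k)); last exact: mX.
exact: continuous_smooth fL.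
Qed.

(** [X k] is built from samples of steps strictly before [k], whose indices differ from [(k, i, l)]
    in the first component. *)
Let avoids_grad k i l j : avoids V (k, i, l) (fun w => grad f (X k w) 0 j).
Proof.
apply: (@measurable_grad_comp _ _ f L L0 fL _
  (g_sigma_algebraType (cylinders_avoiding V (k, i, l))) (X k)) => j'.
apply: (@measurable_zo_iter _ _ f L fL _
  (g_sigma_algebraType (cylinders_avoiding V (k, i, l)))) => k' i' l' kk.
apply: (@avoids_coord _ _ _ _ V (k, i, l) (k', i', l')).
by apply/eqP => -[kk']; move: kk; rewrite kk' ltnn.
Qed.

(** Each product of gradient entries is dominated by |grad f|^2 <= 2L (f - m), which is integrable
    with [f (X k)]. *)
Let has_integral_grad2 k a i j : has_integral P (fun w => f (X k w)) a ->
  exists e, has_integral P (fun w => grad f (X k w) 0 i * grad f (X k w) 0 j) e.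
Proof.
move=> hf.
have hZ := has_integralZ (2 * L) (has_integralD hf (has_integral_cst P (- m))).
apply: (has_integral_dominated _ hZ).
  by apply: measurable_funM; apply: (measurable_grad_comp L0 fL); exact: mX.
move=> w; apply: le_trans (sqn_grad_le L0 fL (X k w) fm).
move: (grad f (X k w)) => g; rewrite normrM.
have h l : `|g 0 l| ^+ 2 <= sqn g.
  rewrite real_normK ?num_real// /sqn (bigD1 l)//= lerDl.
  by apply: sumr_ge0 => ? _; exact: sqr_ge0.
by have := h i; have := h j; have := sqr_ge0 (`|g 0 i| - `|g 0 j|); lra.
Qed.

Lemma iterate_means k :
  [/\ has_integral P (fun w => f (X k w)) (F k),
      has_integral P (fun w => sqn (grad f (X k w))) (A k) &
      F k.+1 <= F k - t / 4 * A k + L * n%:R / 4 * sigma k.+1 ^+ 2].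
Proof.
(* Integrability of [f (X j)] yields every claim at [j] and integrability at [j.+1]; the induction
   starts from the constant [f x0]. *)
suff step j : (exists a, has_integral P (fun w => f (X j w)) a) ->
    [/\ has_integral P (fun w => f (X j w)) (F j),
      has_integral P (fun w => sqn (grad f (X j w))) (A j),
      (exists a, has_integral P (fun w => f (X j.+1 w)) a) &
      F j.+1 <= F j - t / 4 * A j + L * n%:R / 4 * sigma j.+1 ^+ 2].
  have ex j : exists a, has_integral P (fun w => f (X j w)) a.
    elim: j => [|j IH]; last by case: (step j IH).
    by exists (f x0); exact: (has_integral_cst P (f x0)).
  by have [] := step k (ex k).
move=> [a [ia _]].
have hF := integrable_has_integral ia; rewrite -/(F j) in hF.
set s := sigma j.+1; have s0 : 0 < s by exact: sigma0.
pose G w := grad f (X j w).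
have [e he] : exists e, forall i l, has_integral P (fun w => G w 0 i * G w 0 l) (e i l).
  have h i l := has_integral_grad2 i l hF.
  by exists (fun i l => sval (cid (h i l))) => i l; exact: (svalP (cid (h i l))).
have hA := has_integral_sqn he.
have AE : A j = \sum_i e i i.
  exact: (has_integral_uniq (integrable_has_integral (proj1 hA)) hA).
rewrite -AE in hA.
pose us i w : 'rV[R]_n := \row_l U j i l w.
have mV l : measurable_fun setT (V l) by exact: mU.
have lawV l (B : set R) : measurable B ->
  P (V l @^-1` B) = normal_prob 0 (Num.sqrt 2^-1) B by exact: lawU.
have ixinj (i : 'I_N) : injective (fun l : 'I_n => (j, i, l)) by move=> l l' [].
(* [M] is the mean of [step_bound] with |u|^6 replaced by its majorant. It is the same for every
   sample, so averaging over [N] samples leaves it unchanged. *)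
pose M := - (3 / 2) * t * (A j / 2) + t * L ^+ 2 * s ^+ 2 / 2 * (n%:R * (n%:R + 2) / 4)
  + 4 * L * t ^+ 2 * ((n%:R + 2) / 4 * A j)
  + L ^+ 3 * t ^+ 2 * s ^+ 2 * (n%:R ^+ 2 * (3 * n%:R + 12) / 8).
have hB i : exists2 Z, has_integral P Z M & forall w, step_bound f L t s (X j w) (us i w) <= Z w.
  have [Z [hZ sZ]] := has_integral_sqn3_ub mV indU lawV (ixinj i).
  have h2 := has_integral_dot2 mV indU lawV (ixinj i) (fun q l => @avoids_grad j i l q) he.
  have h4 := has_integral_dot2_sqn mV indU lawV (ixinj i) (fun q l => @avoids_grad j i l q) he.
  have hs := has_integral_sqn2 mV indU lawV (ixinj i).
  rewrite -AE in h2 h4.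
  eexists.
    exact: (has_integralD (has_integralD (has_integralD (has_integralZ (- (3 / 2) * t) h2)
      (has_integralZ (t * L ^+ 2 * s ^+ 2 / 2) hs)) (has_integralZ (4 * L * t ^+ 2) h4))
      (has_integralZ (L ^+ 3 * t ^+ 2 * s ^+ 2) hZ)).
  move=> w; rewrite /step_bound lerD2l; apply: ler_wpM2l; last exact: sZ.
  by rewrite !mulr_ge0 ?sqr_ge0 ?exprn_ge0// ltW.
pose Z i := s2val (cid2 (hB i)).
have hZ i : has_integral P (Z i) M by exact: (s2valP (cid2 (hB i))).
have sZ i w : step_bound f L t s (X j w) (us i w) <= Z i w by exact: (s2valP' (cid2 (hB i))).
have NR : 0 < (N%:R : R) by rewrite ltr0n.
have hW : has_integral P (fun w => f (X j w) + N%:R^-1 * \sum_(i < N) Z i w) (F j + M).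
  have := has_integralD hF (has_integralZ N%:R^-1
    (has_integral_sum (p := xpredT) (index_enum 'I_N) (fun i _ => hZ i))).
  by rewrite sumr_const card_ord -[M *+ N]mulr_natl mulKf// gt_eqF.
have le w : f (X j.+1 w) <= f (X j w) + N%:R^-1 * \sum_(i < N) Z i w.
  apply: (le_trans (gest_step L0 fL central (X j w) (fun i => us i w) N0 s0 t0)).
  rewrite lerD2l; apply: ler_wpM2l; first by rewrite invr_ge0 ltW.
  by apply: ler_sum => i _; exact: sZ.
have [b hb] : exists b, has_integral P (fun w => f (X j.+1 w)) b.
  (* Let W be the upper bound of [le]. Since m <= f <= W, the shift |m| - m makes W + |m| - m
     dominate both f and -f. *)
  apply: (has_integral_dominated (mfX j.+1) (has_integralD hW (has_integral_cst P (`|m| - m)))).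
  move=> w; have := le w; have := fm (X j.+1 w); have := ler_norm m.
  by rewrite ler_norml => h1 h2 h3; apply/andP; split; move: (ler_norm (- m)); rewrite normrN; lra.
have hF1 : has_integral P (fun w => f (X j.+1 w)) (F j.+1).
  by apply: integrable_has_integral; case: hb.
split=> //; first by exists b.
apply: (le_trans (le_has_integral hF1 hW le)).
have A0 : 0 <= A j.
  rewrite AE; apply: (le_has_integral (has_integral_cst P 0) (has_integral_sqn he)) => w.
  exact: sqn_ge0.
rewrite -addrA lerD2l /M.
have nR : 0 <= (n%:R : R) by [].
move: (n%:R : R) nR tL4 => q q0 Lt.
(* With w <= 1/2 the gradient terms are at most -3/4 + 1/2 = -1/4 times t A. The noise terms are at
   most K/16 + 3K/32 = 5K/32, below the K/4 claimed. *)
set w := L * t * (q + 4) in Lt.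
set K := L * q * s ^+ 2.
have K0 : 0 <= K by rewrite !mulr_ge0 ?sqr_ge0// ltW.
have Lt0 : 0 <= L * t by rewrite mulr_ge0// ltW.
have w0 : 0 <= w by rewrite mulr_ge0// addr_ge0.
have tA0 : 0 <= t * A j by rewrite mulr_ge0// ltW.
have h1 : t * A j * w <= t * A j * (1 / 2) by apply: ler_wpM2l.
have h2 : 0 <= t * A j * (L * t) by rewrite mulr_ge0.
have h3 : K * w <= K * (1 / 2) by apply: ler_wpM2l.
have h4 : 0 <= K * (L * t) by rewrite mulr_ge0.
have h5 : K * w * w <= K * (1 / 2) * (1 / 2) by apply: ler_pM => //; rewrite mulr_ge0.
have h6 : 0 <= K * w * (L * t) by apply: mulr_ge0 => //; exact: mulr_ge0.
move: K0 h1 h2 h3 h4 h5 h6; rewrite /K /w; lra.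
Qed.

(** The one-step inequalities telescope; the gradient at step i is paired with [sigma i.+1], hence
    the shifted range on the right. *)
Lemma sum_iterate_means k :
  t / 4 * \sum_(i < k) A i <=
  f x0 - F k + L * n%:R / 4 * \sum_(1 <= i < k.+1) sigma i ^+ 2.
Proof.
elim: k => [|k IH].
  have [hF _ _] := iterate_means 0.
  have -> : F 0 = f x0 by exact: (has_integral_uniq hF (has_integral_cst P (f x0))).
  by rewrite big_ord0 big_geq// subrr !mulr0 addr0.
have [_ _] := iterate_means k.
rewrite big_ord_recr big_nat_recr//= mulrDr mulrDr; move: IH; lra.
Qed.

(** The index minimising [A] serves as witness, since a minimum is at most the average. *)
Lemma exists_small_gradient k : (0 < k)%N -> exists2 i : 'I_k,
  has_integral P (fun w => sqn (grad f (X i w))) (A i) &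
  t / 4 * k%:R * A i <=
  f x0 - F k + L * n%:R / 4 * \sum_(1 <= i < k.+1) sigma i ^+ 2.
Proof.
case: k => // k _.
have [i _ imin] := @arg_minP _ _ _ (ord0 : 'I_k.+1) xpredT (fun i => A i) isT.
exists i; first by have [] := iterate_means i.
apply: le_trans (sum_iterate_means k.+1); rewrite -mulrA ler_wpM2l ?divr_ge0 ?(ltW t0)//.
rewrite mulr_natl -[X in _ *+ X]card_ord -sumr_const.
by apply: ler_sum => j _; exact: imin.
Qed.

Lemma expectation_gsmooth_le k : (0 < k)%N ->
  ('E_P[fun w => gsmooth f (sigma k) (X k w)] <=
   (F k + L * n%:R * sigma k ^+ 2 / 4)%:E)%E.
Proof.
move=> k0; have [hF _ _] := iterate_means k.
have [_ <-] := has_integralD hF (has_integral_cst P (L * n%:R * sigma k ^+ 2 / 4)).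
rewrite unlock; apply: le_integral_nomeas => w; rewrite lee_fin.
exact: (gsmooth_le (X k w) L0 fL fm (sigma0 k0)).
Qed.

End descent_in_expectation.

(** * Assembly of the stated bound *)

Unset Implicit Arguments.
Set Strict Implicit.

Theorem theorem4p2 (R : realType) (dim : nat) (f : 'rV[R]_dim -> R) (L : R)
  (sigma : nat -> R) (N : nat) (t : R) (x0 : 'rV[R]_dim) (central : bool)
  (dT : measure_display) (T : measurableType dT) (P : probability T R)
  (U : nat -> 'I_N -> 'I_dim -> T -> R) :
  0 < L ->
  Lsmooth L f ->
  (exists m : R, forall x, m <= f x) ->
  (forall n : nat, (0 < n)%N -> 0 < sigma n) ->
  (1 <= N)%N ->
  0 < t -> t < (2 * L * (dim + 4)%:R)^-1 ->
  (* U k n j = j-th coordinate of the n-th sample used at step k -> k+1 *)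
  (forall k n j, measurable_fun setT (U k n j)) ->
  (forall k n j (B : set R), measurable B ->
     P (U k n j @^-1` B) = normal_prob 0 (Num.sqrt (2^-1)) B) ->
  mutually_independent P (fun i : nat * 'I_N * 'I_dim => U i.1.1 i.1.2 i.2) ->
  let X : nat -> T -> 'rV[R]_dim := fun k w =>
    zo_iter central f t sigma x0 (fun k' n => \row_(j < dim) U k' n j w) k in
  forall k : nat, (1 <= k)%N ->
  (\big[Order.min/+oo%E]_(i < k) 'E_P[(fun w => (enorm (grad f (X i w)) ^+ 2)%R)]
   <= ((k%:R^-1 * (N%:R / (N%:R - 2 * L * t * (dim + 4)%:R)))%:E *
       ((4 / t)%:E * ((f x0)%:E - 'E_P[(fun w => gsmooth f (sigma k) (X k w))])
        + ((L ^+ 3 * t * (dim + 6)%:R ^+ 3 / (4 * N%:R) + 2 * L * dim%:R / t)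
           * \sum_(1 <= i < k.+1) sigma i ^+ 2)%R%:E)))%E.
Proof.
move=> L0 fL [m fm] sigma0 N0 t0 tL mU lawU indU X k k0.
have [i hA hi] := exists_small_gradient L0 fL fm x0 central sigma0 N0 t0 tL mU lawU indU k0.
have hE := expectation_gsmooth_le L0 fL fm x0 central sigma0 N0 t0 tL mU lawU indU k0.
apply: (@bigmin_inf _ _ _ _ i) => //.
set a := Rintegral P _ _ in hA hi.
set Fk := Rintegral P _ _ in hi hE.
have -> : ('E_P[fun w => (enorm (grad f (X i w)) ^+ 2)%R] = a%:E)%E.
  rewrite unlock; case: hA => _ <-; apply: eq_integral => w _.
  by rewrite enorm_sqr.
have a0 : 0 <= a.
  rewrite /a /Rintegral fine_ge0// integral_ge0// => w _.
  by rewrite lee_fin sqn_ge0.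
have NR : 1 <= (N%:R : R) by rewrite ler1n.
have kR : 0 < (k%:R : R) by rewrite ltr0n.
set D := N%:R - 2 * L * t * (dim + 4)%:R.
have D0 : 0 < D.
  have p : 0 < 2 * L * (dim + 4)%:R by rewrite !mulr_gt0// ltr0n addn4.
  by move: tL; rewrite -[ltRHS]mul1r ltr_pdivlMr// /D; lra.
(* Since 0 < D <= N, the prefactor N / D can only enlarge a nonnegative bracket. *)
have DN : 1 <= N%:R / D.
  rewrite ler_pdivlMr// mul1r /D gerBl !mulr_ge0// ltW//.
set S := \sum_(1 <= _ < _) _ in hi *.
set C1 := L ^+ 3 * t * _ / _.
have C10 : 0 <= C1 by rewrite /C1 !mulr_ge0 ?invr_ge0 ?mulr_ge0 ?exprn_ge0// ltW.
(* The last smoothing radius is one of the summands, so the sum can pay for the smoothing correction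
   at step [k]. *)
have S_ge : sigma k ^+ 2 <= S.
  rewrite /S big_nat_recr//= lerDr; apply: sumr_ge0 => j _; exact: sqr_ge0.
have S0 : 0 <= S by apply: le_trans S_ge; exact: sqr_ge0.
have K0 : 0 <= k%:R^-1 * (N%:R / D).
  by rewrite mulr_ge0 ?invr_ge0 ?(ltW kR)// (le_trans _ DN).
have t4 : 0 <= 4 / t by rewrite divr_ge0// ltW.
(* Replacing the mean of the smoothed value by its finite upper bound only lowers the right side,
   and reduces the goal to real numbers. *)
apply: (@le_trans _ _ ((k%:R^-1 * (N%:R / D))%:E * ((4 / t)%:E *
    ((f x0)%:E - (Fk + L * dim%:R * sigma k ^+ 2 / 4)%:E) +
    ((C1 + 2 * L * dim%:R / t) * S)%:E))%E); last first.
  apply: lee_wpmul2l; first by rewrite lee_fin.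
  apply: leeD2r; apply: lee_wpmul2l; first by rewrite lee_fin.
  exact: leeB.
rewrite -EFinB -!EFinM lee_fin.
set y := _ + _.
have y_ge : k%:R * a <= y.
  have e : y = (4 / t) * (f x0 - Fk + L * dim%:R / 4 * S) +
      (L * dim%:R / t) * (S - sigma k ^+ 2) + C1 * S.
    by rewrite /y; field; rewrite gt_eqF.
  rewrite e.
  have := ler_wpM2l t4 hi.
  rewrite (_ : 4 / t * (t / 4 * k%:R * a) = k%:R * a); last by field; rewrite gt_eqF.
  have p1 : 0 <= L * dim%:R / t * (S - sigma k ^+ 2).
    by rewrite mulr_ge0 ?subr_ge0// divr_ge0 ?mulr_ge0// ltW.
  have p2 : 0 <= C1 * S by rewrite mulr_ge0.
  by move: p1 p2; lra.
rewrite -mulrA ler_pdivlMl//; apply: (le_trans y_ge).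
apply: ler_peMl => //; apply: le_trans y_ge; exact: mulr_ge0.
Qed.
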